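(* Let $(R,\mathfrak m,k)$ be a $d$-dimensional $F$-finite Noetherian local domain of characteristic $p>0$, and let $\operatorname{gr}_{\mathfrak m}(R)=\bigoplus_{i\ge 0}\mathfrak m^i/\mathfrak m^{i+1}$ be its associated graded ring. If $\operatorname{gr}_{\mathfrak m}(R)$ is $F$-rational, then $R$ is $F$-rational.
   Context: A ring $R$ of characteristic $p$ is $F$-finite if $F^e_*R$ (that is, $R$ viewed as an $R$-module via restriction of scalars along the $e$-th iterate of Frobenius, $f\mapsto f^{p^e}$) is a finitely generated $R$-module for some (equivalently, all) $e>0$. For an ideal $I$ of a Noetherian ring $R$ of characteristic $p$, $I^{[p^e]}$ denotes the ideal generated by $\{f^{p^e}: f\in I\}$. The tight closure $I^*$ of $I$ is the ideal of all $x\in R$ for which there exists $c\in R$ not contained in any minimal prime of $R$ such that $cx^{q}\in I^{[q]}$ for all large $q=p^e$. A Noetherian ring $R$ of characteristic $p$ is $F$-rational if $J^*=J$ for every ideal $J\subseteq R$ generated by parameters, where elements $x_1,\dots,x_n\in R$ are called parameters if, for every prime $\mathfrak p$ containing $(x_1,\dots,x_n)$, their images in $R_{\mathfrak p}$ form part of a system of parameters of $R_{\mathfrak p}$. *)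

(* Defs.v *)
From HB Require Import structures.
From mathcomp Require Import all_boot all_order all_algebra.
From mathcomp Require Import generic_quotient ring_quotient.
From mathcomp Require Import boolp classical_sets ring.

Set Implicit Arguments.
Unset Strict Implicit.
Unset Printing Implicit Defensive.

Import GRing.Theory.
Local Open Scope ring_scope.
Local Open Scope quotient_scope.
Local Open Scope classical_set_scope.

(* MathComp's [idealr R] and [prime_idealr R] are the *proper* ideals and the
   prime ideals of R, given by boolean predicates; classically this is no
   restriction.  Arbitrary ideals, possibly equal to R, are subsets [set R]
   satisfying [is_ideal]. *)

Section Ideals.
Variable R : comNzRingType.
Implicit Types (I : set R) (m : idealr R) (P Q : prime_idealr R).

Definition is_ideal I : Prop :=
  [/\ I 0, forall x y, I x -> I y -> I (x + y) & forall a x, I x -> I (a * x)].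

Definition ideal_gen (X : set R) : set R := smallest is_ideal X.

Definition radical I : set R := [set x | exists n, I (x ^+ n)].

Definition noetherian : Prop :=
  forall I, is_ideal I -> exists s : seq R, I = ideal_gen [set` s].

Definition maximal_ideal m : Prop :=
  forall J : idealr R, {subset m <= J} -> {subset J <= m}.

Definition local_ring m : Prop :=
  maximal_ideal m /\ forall m' : idealr R, maximal_ideal m' -> m' =i m.

Definition minimal_prime P : Prop :=
  forall Q, {subset Q <= P} -> {subset P <= Q}.

(* Only C 0, ..., C n matter. *)
Definition prime_chain (n : nat) (C : nat -> prime_idealr R) : Prop :=
  forall i, (i < n)%N ->
    {subset C i <= C i.+1} /\ ~ {subset C i.+1 <= C i}.

Definition krull_dim (d : nat) : Prop :=
  (exists C, prime_chain d C) /\ (forall n C, prime_chain n C -> (n <= d)%N).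

(* s consists of dim R elements generating an ideal primary to the maximal
   ideal m; for m maximal this says that the radical is m. *)
Definition system_of_parameters (s : seq R) : Prop :=
  exists m, [/\ local_ring m, krull_dim (size s) &
                radical (ideal_gen [set` s]) = [set` m]].

(* The empty product gives m^0 = R. *)
Definition ideal_exp m (n : nat) : set R :=
  ideal_gen [set \prod_(x <- s) x | s in [set s : n.-tuple R | {subset s <= m}]].

(* I^[q] *)
Definition frobenius_power (q : nat) I : set R :=
  ideal_gen [set f ^+ q | f in I].

Definition tight_closure (p : nat) I : set R :=
  [set x | exists c : R, (forall P, minimal_prime P -> c \notin P) /\
     exists e0 : nat, forall e, (e0 <= e)%N ->
       frobenius_power (p ^ e) I (c * x ^+ (p ^ e))].

End Ideals.

Arguments noetherian : clear implicits.
Arguments krull_dim : clear implicits.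

Section IdealTheory.
Variable R : comNzRingType.
Implicit Types (I X Y : set R) (m : idealr R).

Lemma ideal_gen_ideal X : is_ideal (ideal_gen X).
Proof.
split=> [I [[I0 _ _] _] //|x y Ix Iy I XI|a x Ix I XI].
  by case: (XI) => -[_ ID _] _; apply: ID; [apply: Ix|apply: Iy].
by case: (XI) => -[_ _ IM] _; apply: IM; apply: Ix.
Qed.

Lemma ideal_gen_mul X Y I x y : is_ideal I ->
  (forall u v, X u -> Y v -> I (u * v)) ->
  ideal_gen X x -> ideal_gen Y y -> I (x * y).
Proof.
move=> [I0 ID IM] XYI Xx Yy.
suff H u : X u -> I (u * y).
  apply: (Xx [set z | I (z * y)]); split; last exact: H.
  split=> /= [|a b Ia Ib|a b Ib]; first by rewrite mul0r.
    by rewrite mulrDl; apply: ID.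
  by rewrite -mulrA; apply: IM.
move=> Xu; apply: (Yy [set z | I (u * z)]); split; last by move=> v /= /(XYI u v Xu).
split=> /= [|a b Ia Ib|a b Ib]; first by rewrite mulr0.
  by rewrite mulrDr; apply: ID.
by rewrite mulrCA; apply: IM.
Qed.

Lemma ideal_exp_ideal m n : is_ideal (ideal_exp m n).
Proof. exact: ideal_gen_ideal. Qed.

Lemma ideal_exp0 m : ideal_exp m 0 = setT.
Proof.
apply/seteqP; split=> // x _; rewrite -[x]mulr1.
have [_ _ IM] := ideal_exp_ideal m 0; apply: IM.
by apply: sub_gen_smallest; exists [tuple] => //=; rewrite big_nil.
Qed.

Lemma ideal_expM m i j x y :
  ideal_exp m i x -> ideal_exp m j y -> ideal_exp m (i + j) (x * y).
Proof.
apply: ideal_gen_mul; first exact: ideal_exp_ideal.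
move=> _ _ [s /= sm <-] [t /= tm <-]; rewrite -big_cat /=.
apply: sub_gen_smallest; exists [tuple of s ++ t] => //= z.
by rewrite mem_cat => /orP[/sm|/tm].
Qed.

Lemma ideal_expS m n x : ideal_exp m n.+1 x -> ideal_exp m n x.
Proof.
have [I0 ID IM] := ideal_exp_ideal m n.
apply: smallest_sub => // _ [s /= sm <-].
case/tupleP: s sm => a s sm; rewrite big_cons; apply: IM.
apply: sub_gen_smallest; exists s => //= z zs.
by apply: sm; rewrite inE zs orbT.
Qed.

Lemma ideal_exp1 m x : ideal_exp m 1 x -> x \in m.
Proof.
apply: (@smallest_sub _ _ _ [set` m]) => [|_ [s /= sm <-]] /=.
  split=> [|y z ym zm|a y ym]; [exact: idealr0|exact: rpredD|exact: idealMr].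
case/tupleP: s sm => a s; rewrite (tuple0 s) big_seq1; apply.
by rewrite inE.
Qed.

Lemma is_idealN I x : is_ideal I -> I x -> I (- x).
Proof. by move=> [_ _ IM] Ix; rewrite -mulN1r; apply: IM. Qed.

Lemma is_ideal_sum I (T : Type) (r : seq T) (F : T -> R) :
  is_ideal I -> (forall i, I (F i)) -> I (\sum_(i <- r) F i).
Proof. by move=> [I0 ID _] IF; apply: big_ind. Qed.

End IdealTheory.

(* Localization R_P: fractions a/s with s outside P, where a/s = b/t iff
   u (a t - b s) = 0 for some u outside P. *)

Module Localization.
Section Localization.
Variables (R : comNzRingType) (P : prime_idealr R).

Record denom := Denom { den :> R; denP : den \notin P }.
HB.instance Definition _ := [isSub for den].
HB.instance Definition _ := [Choice of denom by <:].
Definition frac := (R * denom)%type.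
Implicit Types x y z : frac.

Lemma denom1_subproof : 1 \notin P. Proof. by rewrite idealr1. Qed.
Definition denom1 : denom := Denom denom1_subproof.

Lemma denomM_subproof (s t : denom) : den s * den t \notin P.
Proof. by rewrite prime_idealrM negb_or (denP s) (denP t). Qed.
Definition denomM (s t : denom) : denom := Denom (denomM_subproof s t).

Definition equivl x y : bool :=
  `[< exists u : denom,
        den u * (x.1 * den y.2) = den u * (y.1 * den x.2) >].

Lemma equivl_refl : reflexive equivl.
Proof. by move=> x; apply/asboolP; exists denom1. Qed.

Lemma equivl_sym : symmetric equivl.
Proof. by move=> x y; apply/asboolP/asboolP => -[u Hu]; exists u. Qed.

Lemma equivl_trans : transitive equivl.
Proof.
move=> y x z /asboolP[u Hu] /asboolP[v Hv]; apply/asboolP.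
exists (denomM (denomM u v) y.2) => /=.
have -> : den u * den v * den y.2 * (x.1 * den z.2) =
  (den u * (x.1 * den y.2)) * den v * den z.2 by ring.
have -> : den u * den v * den y.2 * (z.1 * den x.2) =
  (den v * (z.1 * den y.2)) * den u * den x.2 by ring.
by rewrite Hu -Hv; ring.
Qed.

Canonical equivl_equiv := EquivRel equivl equivl_refl equivl_sym equivl_trans.

Definition type := {eq_quot equivl}.
HB.instance Definition _ : EqQuotient _ equivl type := EqQuotient.on type.
HB.instance Definition _ := Choice.on type.

Lemma equivlP x y :
  reflect (exists u : denom,
             den u * (x.1 * den y.2) = den u * (y.1 * den x.2))
          (x == y %[mod type]).
Proof. by rewrite eqmodE; apply: asboolP. Qed.

Lemma eq_pi x y (u : denom) :
  den u * (x.1 * den y.2) = den u * (y.1 * den x.2) -> \pi_type x = \pi_type y.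
Proof. by move=> H; apply/eqP/equivlP; exists u. Qed.

Lemma repr_pi x : exists u : denom,
  den u * ((repr (\pi_type x)).1 * den x.2) =
  den u * (x.1 * den (repr (\pi_type x)).2).
Proof. by apply/equivlP; rewrite reprK. Qed.

Definition tolocf (a : R) : frac := (a, denom1).
Definition toloc := lift_embed type tolocf.
Canonical toloc_pi_morph := PiEmbed toloc.

Definition addf x y : frac :=
  (x.1 * den y.2 + y.1 * den x.2, denomM x.2 y.2).
Definition add := lift_op2 type addf.

Lemma pi_add : {morph \pi : x y / addf x y >-> add x y}.
Proof.
move=> x y; unlock add.
have [u Hu] := repr_pi x; have [v Hv] := repr_pi y.
apply: (@eq_pi _ _ (denomM u v)) => /=.
set x' := repr _ in Hu *; set y' := repr _ in Hv *.
transitivity (den v * den y.2 * den y'.2 * (den u * (x.1 * den x'.2))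
            + den u * den x.2 * den x'.2 * (den v * (y.1 * den y'.2))); first ring.
by rewrite -Hu -Hv; ring.
Qed.
Canonical pi_add_morph := PiMorph2 pi_add.

Definition oppf x : frac := (- x.1, x.2).
Definition opp := lift_op1 type oppf.

Lemma pi_opp : {morph \pi : x / oppf x >-> opp x}.
Proof.
move=> x; unlock opp; have [u Hu] := repr_pi x.
by apply: (@eq_pi _ _ u) => /=; rewrite !mulNr !mulrN Hu.
Qed.
Canonical pi_opp_morph := PiMorph1 pi_opp.

Definition mulf x y : frac := (x.1 * y.1, denomM x.2 y.2).
Definition mul := lift_op2 type mulf.

Lemma pi_mul : {morph \pi : x y / mulf x y >-> mul x y}.
Proof.
move=> x y; unlock mul.
have [u Hu] := repr_pi x; have [v Hv] := repr_pi y.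
apply: (@eq_pi _ _ (denomM u v)) => /=.
set x' := repr _ in Hu *; set y' := repr _ in Hv *.
transitivity ((den u * (x.1 * den x'.2)) * (den v * (y.1 * den y'.2))); first ring.
by rewrite -Hu -Hv; ring.
Qed.
Canonical pi_mul_morph := PiMorph2 pi_mul.

Lemma addA : associative add.
Proof.
elim/quotW=> x; elim/quotW=> y; elim/quotW=> z; rewrite !piE.
by apply: (@eq_pi _ _ denom1) => /=; ring.
Qed.

Lemma addC : commutative add.
Proof.
elim/quotW=> x; elim/quotW=> y; rewrite !piE.
by apply: (@eq_pi _ _ denom1) => /=; ring.
Qed.

Lemma add0_l : left_id (toloc 0) add.
Proof.
elim/quotW=> x; rewrite !piE.
by apply: (@eq_pi _ _ denom1) => /=; ring.
Qed.

Lemma addN_l : left_inverse (toloc 0) opp add.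
Proof.
elim/quotW=> x; rewrite !piE.
by apply: (@eq_pi _ _ denom1) => /=; ring.
Qed.

HB.instance Definition _ := GRing.isZmodule.Build type addA addC add0_l addN_l.

Lemma mulA : associative mul.
Proof.
elim/quotW=> x; elim/quotW=> y; elim/quotW=> z; rewrite !piE.
by apply: (@eq_pi _ _ denom1) => /=; ring.
Qed.

Lemma mulC : commutative mul.
Proof.
elim/quotW=> x; elim/quotW=> y; rewrite !piE.
by apply: (@eq_pi _ _ denom1) => /=; ring.
Qed.

Lemma mul1_l : left_id (toloc 1) mul.
Proof.
elim/quotW=> x; rewrite !piE.
by apply: (@eq_pi _ _ denom1) => /=; ring.
Qed.

Lemma mul_addl : left_distributive mul add.
Proof.
elim/quotW=> x; elim/quotW=> y; elim/quotW=> z; rewrite !piE.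
by apply: (@eq_pi _ _ denom1) => /=; ring.
Qed.

Lemma nonzero1 : toloc 1 != toloc 0.
Proof.
rewrite !piE; apply/negP => /asboolP[[u /= uP]].
rewrite !mulr1 mulr0 => u0.
by move: uP; rewrite u0 idealr0.
Qed.

HB.instance Definition _ :=
  GRing.Zmodule_isComNzRing.Build type mulA mulC mul1_l mul_addl nonzero1.

Lemma toloc_is_zmod_morphism : zmod_morphism toloc.
Proof.
move=> a b; unlock toloc; rewrite -[X in _ = _ + X]pi_opp -[RHS]pi_add.
by apply: (@eq_pi _ _ denom1) => /=; ring.
Qed.

Lemma toloc_is_monoid_morphism : monoid_morphism toloc.
Proof.
split=> // a b; unlock toloc; rewrite -[RHS]pi_mul.
by apply: (@eq_pi _ _ denom1) => /=; ring.
Qed.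

HB.instance Definition _ :=
  GRing.isZmodMorphism.Build R type toloc toloc_is_zmod_morphism.
HB.instance Definition _ :=
  GRing.isMonoidMorphism.Build R type toloc toloc_is_monoid_morphism.

End Localization.
End Localization.
HB.export Localization.

Notation localization := Localization.type.
Notation to_localization := Localization.toloc.

(* The graded ring gr_m(R) = (+)_i m^i / m^(i+1) is built as the quotient of
   the Rees algebra (+)_i m^i 'X^i, a subring of {poly R}, by its ideal
   (+)_i m^(i+1) 'X^i. *)

Section AssociatedGraded.
Variables (R : comNzRingType) (m : idealr R).

Definition rees_pred : {pred {poly R}} :=
  fun f => `[< forall i, ideal_exp m i f`_i >].

Lemma rees_subring : subring_closed rees_pred.
Proof.
split=> [|f g /asboolP Hf /asboolP Hg|f g /asboolP Hf /asboolP Hg];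
  apply/asboolP => i.
- rewrite coef1; case: i => [|i]; first by rewrite ideal_exp0.
  by case: (ideal_exp_ideal m i.+1).
- rewrite coefB; have [_ ID _] := ideal_exp_ideal m i.
  apply: ID => //; apply: (@is_idealN _ (ideal_exp m i)) => //.
  exact: ideal_exp_ideal.
- rewrite coefM; apply: (@is_ideal_sum _ (ideal_exp m i)); first exact: ideal_exp_ideal.
  move=> j; have := ideal_expM (Hf j) (Hg (i - j)%N).
  by rewrite subnKC // -ltnS.
Qed.

HB.instance Definition _ :=
  GRing.isSubringClosed.Build {poly R} rees_pred rees_subring.

Record rees := Rees { rees_poly :> {poly R}; _ : rees_poly \in rees_pred }.

HB.instance Definition _ := [isSub for rees_poly].
HB.instance Definition _ := [Choice of rees by <:].
HB.instance Definition _ := [SubChoice_isSubComNzRing of rees by <:].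

Definition gr_ideal : pred rees :=
  fun f => `[< forall i, ideal_exp m i.+1 (val f)`_i >].

Lemma gr_ideal_closed : idealr_closed gr_ideal.
Proof.
split.
- by apply/asboolP => i; rewrite coef0; case: (ideal_exp_ideal m i.+1).
- apply/negP => /asboolP/(_ 0%N); rewrite coef1 /= => /ideal_exp1.
  by rewrite idealr1.
- move=> a f g /asboolP Hf /asboolP Hg; apply/asboolP => i.
  have Ii := ideal_exp_ideal m i.+1; have [_ ID _] := Ii.
  rewrite coefD coefM; apply: ID => //.
  apply: (@is_ideal_sum _ (ideal_exp m i.+1)) => // j.
  have /asboolP/(_ j) Ha := valP a.
  have := ideal_expM Ha (Hf (i - j)%N).
  by rewrite addnS subnKC // -ltnS.
Qed.

HB.instance Definition _ := isIdealr.Build rees gr_ideal gr_ideal_closed.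
Definition gr_idealr : idealr rees := Idealr.clone rees gr_ideal _.

Definition assoc_graded : comNzRingType := {ideal_quot gr_idealr}.

Lemma assoc_gradedP (f g : rees) :
  reflect (forall i, ideal_exp m i.+1 ((val f)`_i - (val g)`_i))
          (f == g %[mod {ideal_quot gr_idealr}]).
Proof.
rewrite -Quotient.idealrBE; apply: (iffP (asboolP _)) => H i;
  by have := H i; rewrite coefB.
Qed.

End AssociatedGraded.

(* F^e_* R is [restr_scalars (frobenius_iter pcharRp e)]: the ring R with the
   R-module structure a *: x = a ^+ (p ^ e) * x. *)

Section Frobenius.
Variables (R : comNzRingType) (p : nat).

Definition restr_scalars (S : comNzRingType) (f : {rmorphism R -> S}) : Type := S.

Section RestrictionOfScalars.
Variables (S : comNzRingType) (f : {rmorphism R -> S}).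
Local Notation M := (restr_scalars f).

HB.instance Definition _ := GRing.Zmodule.copy M S.

Definition restr_scale (a : R) (x : M) : M := f a * (x : S).

Lemma restr_scaleA a b x : restr_scale a (restr_scale b x) = restr_scale (a * b) x.
Proof. by rewrite /restr_scale rmorphM mulrA. Qed.
Lemma restr_scale1 : left_id 1 restr_scale.
Proof. by move=> x; rewrite /restr_scale rmorph1 mul1r. Qed.
Lemma restr_scaleDr : right_distributive restr_scale +%R.
Proof. by move=> a x y; apply: mulrDr. Qed.
Lemma restr_scaleDl x : {morph restr_scale^~ x : a b / a + b}.
Proof. by move=> a b; rewrite /restr_scale rmorphD; apply: mulrDl. Qed.

HB.instance Definition _ := GRing.Zmodule_isLmodule.Build R M
  restr_scaleA restr_scale1 restr_scaleDr restr_scaleDl.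

End RestrictionOfScalars.

Definition fin_gen_module (M : lmodType R) : Prop :=
  exists s : seq M, forall x : M, exists a : nat -> R,
    x = \sum_(i < size s) a i *: s`_i.

Variable pcharRp : p \in [pchar R].

Definition frobenius_iter of p \in [pchar R] := fun (e : nat) (x : R) => x ^+ (p ^ e).
Local Notation F := (frobenius_iter pcharRp).

Lemma frobenius_iter_zmod e : zmod_morphism (F e).
Proof.
have pc : [pchar R].-nat (p ^ e)%N.
  by rewrite pnatX pnatE ?pcharRp // (pcharf_prime pcharRp).
by move=> x y; rewrite /frobenius_iter exprDn_pchar // exprNn_pchar.
Qed.

Lemma frobenius_iter_monoid e : monoid_morphism (F e).
Proof. by split=> [|x y]; rewrite /frobenius_iter ?expr1n ?exprMn. Qed.

HB.instance Definition _ e :=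
  GRing.isZmodMorphism.Build R R (F e) (frobenius_iter_zmod e).
HB.instance Definition _ e :=
  GRing.isMonoidMorphism.Build R R (F e) (frobenius_iter_monoid e).

Definition F_finite : Prop :=
  exists e : nat, (0 < e)%N /\ fin_gen_module (restr_scalars (F e)).

End Frobenius.

Section FRational.
Variable R : comNzRingType.

Definition parameters (s : seq R) : Prop :=
  forall P : prime_idealr R, ideal_gen [set` s] `<=` [set` P] ->
    exists t : seq (localization P),
      system_of_parameters (map (to_localization P) s ++ t).

Definition F_rational (p : nat) : Prop :=
  [/\ p \in [pchar R], noetherian R &
      forall s : seq R, parameters s ->
        tight_closure p (ideal_gen [set` s]) = ideal_gen [set` s]].

End FRational.

Arguments F_rational : clear implicits.

(* Main.v *)
Require Import Defs.
From HB Require Import structures.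
From mathcomp Require Import all_boot all_order all_algebra.
From mathcomp Require Import generic_quotient ring_quotient.
From mathcomp Require Import boolp classical_sets ring zify.

Set Implicit Arguments.
Unset Strict Implicit.
Unset Printing Implicit Defensive.

Import GRing.Theory.
Local Open Scope ring_scope.
Local Open Scope classical_set_scope.
Local Open Scope quotient_scope.

(** Write G = gr_m(R).  An ideal x = (x_1, ..., x_n) of R whose initial forms
    y_i are a homogeneous system of parameters and a regular sequence of G is
    tightly closed: if c z^q is in (x_1^q, ..., x_n^q) for all large q, then,
    as no cancellation in low degrees is possible for a regular sequence of
    initial forms ([filtered_span_lift]), in(c) in(z)^q is in
    (y_1^q, ..., y_n^q).  As G is a domain, in(c) is a valid multiplier, and
    F-rationality of G puts in(z) in (y_1, ..., y_n).  So z can be changed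
    modulo x to have higher and higher order, and is in x by Krull's
    intersection theorem ([lifts_tight_closed]).

    This asks two things of G.  It is a domain: if a b = 0 with a, b
    homogeneous and nonzero, some homogeneous y with a y = 0 makes a + y a
    nonzerodivisor; since (a + y) a^q = a (a + y)^q, the element a is in the
    tight closure of (a + y), hence in (a + y), and this forces y = 0 and b = 0
    ([frational_graded_domain]).  And a system y_1, ..., y_n chosen by
    homogeneous prime avoidance is a regular sequence
    ([homog_system_regular]).  This is colon capturing: with k = G_0, the ring
    G is finite over the subring S = k[y_1, ..., y_n], some nonzero c in S
    multiplies G into a free S-module, and S behaves as a polynomial ring in
    the y_i.  So if y_(i+1) z is in (y_1, ..., y_i), then c z^q is in
    (y_1^q, ..., y_i^q) for all q.  The latter ideal is the q-th Frobenius power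
    of an ideal generated by parameters, because a regular sequence of a
    noetherian ring always is a sequence of parameters
    ([regular_parameters]).  For that one needs that the localizations of G
    have finite dimension, hence Krull's height theorem ([krull_height]), which
    is derived from the principal ideal theorem
    ([principal_ideal_theorem]).

    It remains to pass from one m-primary ideal generated by a regular sequence
    to all parameter ideals of R.  Being a regular sequence and generating a
    tightly closed ideal is inherited when one generator is replaced by a
    power ([regular_closed_pow]), when it is exchanged against another element
    ([regular_closed_exchange]), and when it is dropped
    ([regular_closed_drop]).  Any two systems of parameters are connected by
    exchanges ([regular_closed_connect]), and a sequence of parameters is a
    system of parameters from which some elements are dropped. *)

(** * Ideals and modules spanned by a sequence *)

Section Span.
Variable A : comNzRingType.
Implicit Types (M S : set A) (l : seq A) (I J : set A).

(** The coefficients range over a set M, so that one notion covers ideals, their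
    analogues over a subring of A, and combinations of l with coefficients in a
    submodule. *)
Fixpoint lspan M l : set A :=
  if l is y :: l' then
    [set x | exists a r, [/\ M a, lspan M l' r & x = a * y + r]]
  else [set 0].

Definition is_subring S : Prop :=
  [/\ S 0, S 1, forall x y, S x -> S y -> S (x - y) &
      forall x y, S x -> S y -> S (x * y)].

Definition add_closed M : Prop :=
  M 0 /\ forall x y, M x -> M y -> M (x - y).

Lemma subring_add S : is_subring S -> add_closed S.
Proof. by case. Qed.

Lemma subringT : is_subring setT.
Proof. by []. Qed.

Lemma ideal_add I : is_ideal I -> add_closed I.
Proof.
move=> hI; have [I0 ID _] := hI; split=> // x y Ix Iy.
by apply: ID => //; apply: is_idealN.
Qed.

Lemma add_closedN M x : add_closed M -> M x -> M (- x).
Proof. by move=> [M0 MB] Mx; rewrite -[- x]add0r; apply: MB. Qed.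

Lemma add_closedD M x y : add_closed M -> M x -> M y -> M (x + y).
Proof.
by move=> hM Mx My; rewrite -[y]opprK; apply: hM.2 => //; apply: add_closedN.
Qed.

Lemma lspan_add_closed M l : add_closed M -> add_closed (lspan M l).
Proof.
move=> hM; have [M0 MB] := hM; elim: l => [|y l [IH0 IHB]] /=.
  by split=> // x y -> ->; rewrite subr0.
split; first by exists 0, 0; split=> //; rewrite mul0r addr0.
move=> _ _ [a [r [Ma Sr ->]]] [b [t [Mb St ->]]].
by exists (a - b), (r - t); split; [exact: MB|exact: IHB|ring].
Qed.

Lemma lspan_mull M M' l (c x : A) :
  (forall a, M a -> M' (c * a)) -> lspan M l x -> lspan M' l (c * x).
Proof.
move=> cM; elim: l x => [|y l IH] x /=; first by move=> ->; rewrite mulr0.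
move=> [a [r [Ma Sr ->]]]; exists (c * a), (c * r).
by split; [exact: cM|exact: IH|ring].
Qed.

Lemma lspan_mono M M' l : M `<=` M' -> lspan M l `<=` lspan M' l.
Proof.
move=> MM'; elim: l => [|y l IH] x //= [a [r [Ma Sr ->]]].
by exists a, r; split; [exact: MM'|exact: IH|].
Qed.

Lemma lspan_mem_mul M l a y : M 0 -> M a -> y \in l -> lspan M l (a * y).
Proof.
move=> M0 Ma; elim: l => // z l IH; rewrite inE => /orP[/eqP<-|/IH h] /=.
  exists a, 0; split=> //; last by rewrite addr0.
  by elim: l {IH} => //= u l IH; exists 0, 0; split=> //; rewrite mul0r addr0.
by exists 0, (a * y); split=> //; rewrite mul0r add0r.
Qed.

Lemma lspan_sub M l (T : set A) : add_closed T ->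
  (forall a y, M a -> y \in l -> T (a * y)) -> lspan M l `<=` T.
Proof.
move=> hT; elim: l => [|y l IH] h x /=; first by move=> ->; case: hT.
move=> [a [r [Ma Sr ->]]]; apply: add_closedD => //.
  by apply: h => //; rewrite mem_head.
by apply: IH => // b z Mb zl; apply: h => //; rewrite inE zl orbT.
Qed.

Lemma lspan_subseq M l l' : add_closed M -> {subset l <= l'} ->
  lspan M l `<=` lspan M l'.
Proof.
move=> hM ll'; apply: lspan_sub; first exact: lspan_add_closed.
by move=> a y Ma yl; apply: lspan_mem_mul => //; [case: hM|exact: ll'].
Qed.

Lemma eq_mem_lspan M l l' : add_closed M -> l =i l' -> lspan M l = lspan M l'.
Proof.
by move=> hM e; apply/seteqP; split; apply: lspan_subseq => // x; rewrite e.
Qed.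

Lemma lspan_cons M l y x : add_closed M -> lspan M l x -> lspan M (y :: l) x.
Proof.
by move=> hM; apply: lspan_subseq => // z zl; rewrite inE zl orbT.
Qed.

Lemma lspan_ideal l : is_ideal (lspan setT l).
Proof.
have h : add_closed (lspan setT l) by apply: lspan_add_closed.
split=> [|x y Sx Sy|a x Sx]; [by case: h|exact: add_closedD|exact: (lspan_mull (M := setT))].
Qed.

Lemma ideal_genE l : ideal_gen [set` l] = lspan setT l.
Proof.
apply/seteqP; split.
  apply: smallest_sub; first exact: lspan_ideal.
  by move=> y yl; rewrite -[y]mul1r; apply: lspan_mem_mul.
have hI := ideal_gen_ideal [set` l].
apply: lspan_sub; first exact: ideal_add.
move=> a y _ yl; have [_ _ IM] := hI; apply: IM.
exact: sub_gen_smallest.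
Qed.

Lemma mem_lspan l y : y \in l -> lspan setT l y.
Proof. by move=> yl; rewrite -[y]mul1r; apply: lspan_mem_mul. Qed.

Lemma lspan_le_ideal l I : is_ideal I -> (forall y, y \in l -> I y) ->
  lspan setT l `<=` I.
Proof.
move=> hI h; have [_ _ IM] := hI.
by apply: lspan_sub; [exact: ideal_add|move=> a y _ /h/IM].
Qed.

(** I + (a) *)
Definition adjoin I a : set A := [set x | exists r, I (x - r * a)].

Lemma adjoin_ideal I a : is_ideal I -> is_ideal (adjoin I a).
Proof.
move=> hI; have [I0 ID IM] := hI; split.
- by exists 0; rewrite mul0r subr0.
- move=> x y [r hr] [t ht]; exists (r + t).
  by have := ID _ _ hr ht; congr I; ring.
- move=> b x [r hr]; exists (b * r).
  by have := IM b _ hr; congr I; ring.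
Qed.

Lemma adjoin_sub I a : is_ideal I -> I `<=` adjoin I a.
Proof. by move=> hI x Ix; exists 0; rewrite mul0r subr0. Qed.

Lemma adjoin_self I a : is_ideal I -> adjoin I a a.
Proof. by case=> I0 _ _; exists 1; rewrite mul1r subrr. Qed.

Lemma adjoin_le I J a : is_ideal J -> I `<=` J -> J a -> adjoin I a `<=` J.
Proof.
move=> [_ JD JM] IJ Ja x [r hr].
by rewrite -(subrK (r * a) x); apply: JD; [exact: IJ|exact: JM].
Qed.

(** * Noetherian rings and minimal primes *)

Definition set_prime (P : set A) : Prop :=
  [/\ is_ideal P, ~ P 1 & forall a b, P (a * b) -> P a \/ P b].

Lemma is_ideal0 I : is_ideal I -> I 0. Proof. by case. Qed.
Lemma is_idealD I a b : is_ideal I -> I a -> I b -> I (a + b).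
Proof. by case=> _ h _; apply: h. Qed.
Lemma is_idealMl I a b : is_ideal I -> I b -> I (a * b).
Proof. by case=> _ _ h; apply: h. Qed.
Lemma is_idealMr I a b : is_ideal I -> I a -> I (a * b).
Proof. by move=> hI Ia; rewrite mulrC; apply: is_idealMl. Qed.
Lemma is_idealB I a b : is_ideal I -> I a -> I b -> I (a - b).
Proof. by move=> /ideal_add[_ h]; apply: h. Qed.

Lemma adjoin_mul I a b x y r t : is_ideal I -> I (a * b) ->
  I (x - r * a) -> I (y - t * b) -> I (x * y).
Proof.
move=> hI Iab hr ht.
have -> : x * y = x * (y - t * b) + t * b * (x - r * a) + r * t * (a * b) by ring.
by apply: is_idealD => //; [apply: is_idealD => //|]; apply: is_idealMl.
Qed.

Lemma noeth_chain (N : nat -> set A) : noetherian A ->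
  (forall n, is_ideal (N n)) -> (forall n, N n `<=` N n.+1) ->
  exists n, forall k, N k `<=` N n.
Proof.
move=> noeA hN inc.
have mono i j : (i <= j)%N -> N i `<=` N j.
  move=> /subnK<-; elim: (j - i)%N => [//|k IH] x /IH; exact: inc.
pose U := [set x | exists n, N n x].
have hU : is_ideal U.
  split; first by exists 0%N; apply: is_ideal0.
    move=> x y [i hi] [j hj]; exists (maxn i j); apply: is_idealD => //.
      exact: mono (leq_maxl i j) _ hi.
    exact: mono (leq_maxr i j) _ hj.
  by move=> a x [i hi]; exists i; apply: is_idealMl.
have [s Us] := noeA _ hU.
have [n hn] : exists n, forall x, x \in s -> N n x.
  have : forall x, x \in s -> U x.
    by move=> x xs; rewrite Us; apply: sub_gen_smallest.
  elim: s {Us} => [|x s IH] h; first by exists 0%N.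
  have [|n hn] := IH; first by move=> y ys; apply: h; rewrite inE ys orbT.
  have [k hk] := h x (mem_head _ _).
  exists (maxn n k) => y; rewrite inE => /orP[/eqP->|/hn].
    exact: mono (leq_maxr n k) _ hk.
  exact: mono (leq_maxl n k) _.
exists n => k x Nx; have: U x by exists k.
rewrite Us ideal_genE; exact: lspan_le_ideal.
Qed.

(** Without a maximal element, choice gives a strictly increasing sequence in F. *)
Lemma noeth_max (F : set (set A)) J0 : noetherian A ->
  (forall I, F I -> is_ideal I) -> F J0 ->
  exists2 I, F I & J0 `<=` I /\ forall J, F J -> I `<=` J -> J `<=` I.
Proof.
move=> noeA hF FJ0; apply: contrapT => hno.
have step (I : {I | F I /\ J0 `<=` I}) :
    exists J : {I | F I /\ J0 `<=` I}, sval I `<=` sval J /\ ~ (sval J `<=` sval I).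
  case: I => I [FI J0I] /=; apply: contrapT => h; apply: hno; exists I => //.
  split=> // J FJ IJ; apply: contrapT => nJI; apply: h.
  have J0J : J0 `<=` J by move=> x /J0I/IJ.
  by exists (exist _ J (conj FJ J0J)).
have [f hf] := choice step.
pose g n := iter n f (exist _ J0 (conj FJ0 (fun x h => h))).
have [||n hn] := @noeth_chain (fun n => sval (g n)) noeA.
- by move=> n; apply: hF; case: (g n) => ? [].
- by move=> n; apply: (hf (g n)).1.
- exact: (hf (g n)).2 (hn n.+1).
Qed.

Lemma noeth_ind (F : set A -> Prop) : noetherian A ->
  (forall I, is_ideal I ->
     (forall J, is_ideal J -> I `<=` J -> ~ (J `<=` I) -> F J) -> F I) ->
  forall I, is_ideal I -> F I.
Proof.
move=> noeA step I hI; apply: contrapT => nFI.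
have [|//|J [hJ nFJ] [_ mx]] := @noeth_max [set J | is_ideal J /\ ~ F J] I noeA.
  by move=> J [].
apply: nFJ; apply: step => // K hK JK nKJ.
by apply: contrapT => nFK; apply: nKJ; apply: mx.
Qed.

Lemma prime_prodN P l : set_prime P -> (forall u, u \in l -> ~ P u) ->
  ~ P (\prod_(u <- l) u).
Proof.
move=> [hP nP1 PM]; elim: l => [|u l IH] h; first by rewrite big_nil.
rewrite big_cons => /PM[]; first by apply: h; rewrite mem_head.
by apply: IH => v vl; apply: h; rewrite inE vl orbT.
Qed.

Lemma primeX P a n : set_prime P -> P (a ^+ n) -> P a.
Proof.
move=> hP; have [_ nP1 PM] := hP; elim: n => [|n IH]; first by rewrite expr0.
by rewrite exprS => /PM[].
Qed.

Lemma primeNM P a b : set_prime P -> ~ P a -> ~ P b -> ~ P (a * b).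
Proof. by move=> [_ _ PM] ha hb /PM[]. Qed.

Lemma primeNX P a n : set_prime P -> ~ P a -> ~ P (a ^+ n).
Proof. by move=> hP ha /(primeX hP). Qed.

End Span.

Section Decomposition.
Variables (A : comNzRingType) (noeA : noetherian A).
Implicit Types (I J P Q : set A) (L : seq (set A)).

Definition minimal_over I P : Prop :=
  [/\ set_prime P, I `<=` P &
      forall Q, set_prime Q -> I `<=` Q -> Q `<=` P -> P `<=` Q].

(** Minimal primes are found inside a class C of ideals, so that the homogeneous
    ones are obtained at the same time: C is either the class of all ideals or
    that of the homogeneous ideals, and H the set of the elements, respectively
    the homogeneous elements, on which primality of an ideal of C can be tested. *)
Section Class.
Variables (C : set (set A)) (H : set A).
Hypothesis C_adjoin : forall I a, C I -> H a -> C (adjoin I a).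
Hypothesis C_prime : forall I, C I -> is_ideal I -> ~ I 1 ->
  (forall a b, H a -> H b -> I (a * b) -> I a \/ I b) -> set_prime I.

(** Noetherian induction: if a b is in I while a and b are not, then the product
    of I + (a) and I + (b) is in I. *)
Lemma prime_product I : is_ideal I -> C I -> exists L : seq (set A),
  (forall P, P \in L -> [/\ C P, set_prime P & I `<=` P]) /\
  forall u : set A -> A, (forall P, P \in L -> P (u P)) -> I (\prod_(P <- L) u P).
Proof.
move: I; apply: noeth_ind => // I hI IH CI.
have [I1|nI1] := pselect (I 1).
  by exists [::]; split=> // u _; rewrite big_nil.
have [h|] := pselect (forall a b, H a -> H b -> I (a * b) -> I a \/ I b).
  exists [:: I]; split=> [P|u hu].
    by rewrite inE => /eqP->; split=> //; apply: C_prime.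
  by rewrite big_seq1; apply: hu; rewrite inE.
move=> /existsNP[a /existsNP[b /not_implyP[Ha /not_implyP[Hb]]]].
move=> /not_implyP[Iab /not_orP[nIa nIb]].
have step c : H c -> ~ I c -> exists L : seq (set A),
    (forall P, P \in L -> [/\ C P, set_prime P & adjoin I c `<=` P]) /\
    forall u : set A -> A, (forall P, P \in L -> P (u P)) ->
      adjoin I c (\prod_(P <- L) u P).
  move=> Hc nIc; apply: IH; first exact: adjoin_ideal.
  - exact: adjoin_sub.
  - by move=> /(_ c (adjoin_self _ hI)).
  - exact: C_adjoin.
have [L1 [hL1 pL1]] := step a Ha nIa; have [L2 [hL2 pL2]] := step b Hb nIb.
exists (L1 ++ L2); split=> [P|u hu].
  rewrite mem_cat => /orP[/hL1|/hL2] [CP pP IP]; split=> // x Ix.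
    by apply: IP; apply: adjoin_sub.
  by apply: IP; apply: adjoin_sub.
rewrite big_cat /=.
have [r hr] : adjoin I a (\prod_(P <- L1) u P).
  by apply: pL1 => P PL; apply: hu; rewrite mem_cat PL.
have [t ht] : adjoin I b (\prod_(P <- L2) u P).
  by apply: pL2 => P PL; apply: hu; rewrite mem_cat PL orbT.
exact: (adjoin_mul hI Iab hr ht).
Qed.

Lemma exists_prime_outside L Q : set_prime Q ->
  (forall P, P \in L -> ~ P `<=` Q) ->
  exists u : set A -> A, (forall P, P \in L -> P (u P)) /\
     forall P, P \in L -> ~ Q (u P).
Proof.
move=> pQ h.
have /choice[u hu] : forall P : set A, exists a, P \in L -> P a /\ ~ Q a.
  move=> P.
  have [PL|nPL] := boolP (P \in L); last by exists 0.
  by have /existsNP[a /not_implyP[]] := h P PL; exists a.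
by exists u; split=> P /hu[].
Qed.

Lemma prime_cover_le I L Q : set_prime Q -> I `<=` Q ->
  (forall u : set A -> A, (forall P, P \in L -> P (u P)) -> I (\prod_(P <- L) u P)) ->
  exists2 P, P \in L & P `<=` Q.
Proof.
move=> pQ IQ hL; apply: contrapT => no.
have [|u [hu nu]] := @exists_prime_outside L Q pQ.
  by move=> P PL PQ; apply: no; exists P.
have := IQ _ (hL u hu).
rewrite -(big_map u xpredT id); apply: prime_prodN => // x /mapP[P PL ->].
exact: nu.
Qed.

Lemma minimal_in_seq L P : P \in L ->
  exists2 P', P' \in L & P' `<=` P /\ forall Q, Q \in L -> Q `<=` P' -> P' `<=` Q.
Proof.
elim: L P => // Z L IH P.
have key P0 : P0 \in L -> exists2 P', P' \in Z :: L &
    P' `<=` P0 /\ forall Q, Q \in Z :: L -> Q `<=` P' -> P' `<=` Q.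
  move=> /IH[P' P'L [P'P mn]].
  have [ZP'|nZP'] := pselect (Z `<=` P').
    exists Z; first exact: mem_head.
    split=> [x /ZP'/P'P //|Q]; rewrite inE => /orP[/eqP-> //|QL] QZ x Zx.
    by apply: (mn Q QL) => [y /QZ/ZP'|]; last exact: ZP'.
  exists P'; first by rewrite inE P'L orbT.
  by split=> // Q; rewrite inE => /orP[/eqP->//|]; apply: mn.
rewrite inE => /orP[/eqP->|]; last exact: key.
have [[Q QL QZ]|no] := pselect (exists2 Q, Q \in L & Q `<=` Z).
  have [P' P'L [P'Q mn]] := key Q QL.
  by exists P' => //; split=> // x /P'Q/QZ.
exists Z; first exact: mem_head.
split=> // Q; rewrite inE => /orP[/eqP->//|QL] QZ.
by case: no; exists Q.
Qed.

Lemma minimal_primes_class I : is_ideal I -> C I -> exists L : seq (set A),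
  (forall P, P \in L -> C P /\ minimal_over I P) /\
  forall Q, set_prime Q -> I `<=` Q -> exists2 P, P \in L & P `<=` Q.
Proof.
move=> hI CI; have [L [hL pL]] := prime_product hI CI.
exists [seq P <- L | `[< forall Q, Q \in L -> Q `<=` P -> P `<=` Q >]].
split=> [P|Q pQ IQ].
  rewrite mem_filter => /andP[/asboolP mn PL].
  have [CP pP IP] := hL P PL; split=> //; split=> // Q pQ IQ QP x Px.
  have [P' P'L P'Q] := prime_cover_le pQ IQ pL.
  by apply: (P'Q); apply: (mn P' P'L) => // y /P'Q/QP.
have [P PL PQ] := prime_cover_le pQ IQ pL.
have [P' P'L [P'P mn]] := minimal_in_seq PL.
exists P'; first by rewrite mem_filter P'L andbT; apply/asboolP.
by move=> x /P'P/PQ.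
Qed.

End Class.

Lemma prime_product_ideal I : is_ideal I -> exists L : seq (set A),
  (forall P, P \in L -> set_prime P /\ I `<=` P) /\
  forall u : set A -> A, (forall P, P \in L -> P (u P)) -> I (\prod_(P <- L) u P).
Proof.
move=> hI; have [||//|L [hL pL]] := @prime_product (@is_ideal A) setT _ _ I hI.
- by move=> J a hJ _; apply: adjoin_ideal.
- by move=> J hJ _ nJ h; split=> // a b; apply: h.
by exists L; split=> // P /hL[].
Qed.

Lemma minimal_primes I : is_ideal I -> exists L : seq (set A),
  (forall P, P \in L -> minimal_over I P) /\
  forall Q, set_prime Q -> I `<=` Q -> exists2 P, P \in L & P `<=` Q.
Proof.
move=> hI; have [||//|L [hL pL]] := @minimal_primes_class (@is_ideal A) setT _ _ I hI.
- by move=> J a hJ _; apply: adjoin_ideal.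
- by move=> J hJ _ nJ h; split=> // a b; apply: h.
by exists L; split=> // P /hL[].
Qed.

Lemma exists_minimal_le I Q : is_ideal I -> set_prime Q -> I `<=` Q ->
  exists2 P, minimal_over I P & P `<=` Q.
Proof.
move=> hI pQ IQ; have [L [hL pL]] := minimal_primes hI.
by have [P /hL mP PQ] := pL Q pQ IQ; exists P.
Qed.

(** In a product of primes contained in I, take a in the factors equal to Q and
    elements outside Q in the others. *)
Lemma minimal_over_zdiv I Q a : is_ideal I -> minimal_over I Q -> Q a ->
  exists s k, ~ Q s /\ I (s * a ^+ k).
Proof.
move=> hI [pQ IQ mQ] Qa; have [L [hL pL]] := prime_product_ideal hI.
have /choice[u hu] : forall P : set A, exists x, P \in L ->
    P x /\ (x = a \/ ~ Q x).
  move=> P.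
  have [PL|nPL] := boolP (P \in L); last by exists 0.
  have [PQ|/existsNP[x /not_implyP[Px nQx]]] := pselect (P `<=` Q).
    have [pP IP] := hL P PL.
    by exists a => _; split; [apply: mQ Qa|left].
  by exists x => _; split=> //; right.
have [s [k [nQs e]]] : exists s k, ~ Q s /\ \prod_(P <- L) u P = s * a ^+ k.
  have : forall P, P \in L -> u P = a \/ ~ Q (u P) by move=> P /hu[].
  elim: L {hL pL hu} => [|P L IH] h.
    by exists 1, 0%N; rewrite big_nil mulr1; case: pQ.
  have [|s [k [nQs e]]] := IH; first by move=> R RL; apply: h; rewrite inE RL orbT.
  rewrite big_cons e; case: (h P (mem_head _ _)) => [->|nQu].
    by exists s, k.+1; split=> //; rewrite exprS; ring.
  by exists (u P * s), k; split; [exact: primeNM|ring].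
by exists s, k; split=> //; rewrite -e; apply: pL => P /hu[].
Qed.

Lemma radical_primes I a : is_ideal I ->
  (forall P, set_prime P -> I `<=` P -> P a) -> exists n, I (a ^+ n).
Proof.
move=> hI h; have [L [hL pL]] := prime_product_ideal hI.
exists (size L); have := pL (fun=> a).
by rewrite big_const_seq count_predT -Monoid.iteropE; apply=> P /hL[]; apply: h.
Qed.

(** Noetherian induction on J as for [prime_product]; if J is prime, I is in J. *)
Lemma power_sub_radical I J : is_ideal J ->
  (forall a, I a -> exists n, J (a ^+ n)) ->
  exists N, forall s : seq A, (forall x, x \in s -> I x) -> size s = N ->
    J (\prod_(x <- s) x).
Proof.
move=> hJ; elim/noeth_ind: J / hJ => // J hJ IH h.
have [J1|nJ1] := pselect (J 1).
  by exists 0%N => s _ /size0nil ->; rewrite big_nil.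
have [pJ|] := pselect (forall a b, J (a * b) -> J a \/ J b).
  exists 1%N => -[|x []] // sI _; rewrite big_seq1.
  have [n] := h x (sI _ (mem_head _ _)).
  exact: (primeX (And3 hJ nJ1 pJ)).
move=> /existsNP[a /existsNP[b /not_implyP[Jab /not_orP[nJa nJb]]]].
have step c : ~ J c -> exists N, forall s : seq A, (forall x, x \in s -> I x) ->
    size s = N -> adjoin J c (\prod_(x <- s) x).
  move=> nJc; apply: IH; first exact: adjoin_ideal.
  - exact: adjoin_sub.
  - by move=> /(_ c (adjoin_self _ hJ)).
  - by move=> x /h[n Jx]; exists n; apply: adjoin_sub.
have [N1 h1] := step a nJa; have [N2 h2] := step b nJb.
exists (N1 + N2)%N => s sI ss; rewrite -(cat_take_drop N1 s) big_cat /=.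
have [r hr] : adjoin J a (\prod_(x <- take N1 s) x).
  by apply: h1 => [x /mem_take/sI //|]; rewrite size_takel // ss leq_addr.
have [t ht] : adjoin J b (\prod_(x <- drop N1 s) x).
  by apply: h2 => [x /mem_drop/sI //|]; rewrite size_drop ss addKn.
exact: (adjoin_mul hJ Jab hr ht).
Qed.
End Decomposition.

(** * Prime avoidance *)

Section Avoidance.
Variables (A : comNzRingType) (H : set A).
Implicit Types (J P : set A) (L : seq (set A)).
(** The avoiding element is looked for in H: all elements, or the homogeneous
    ones of positive degree, of which suitable powers have the same degree and
    can be added. *)
Hypothesis H_mul : forall x y, H x -> H y -> H (x * y).
Hypothesis H_add : forall x y, H x -> H y ->
  exists a b, [/\ (0 < a)%N, (0 < b)%N & H (x ^+ a + y ^+ b)].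

(** By induction every prime Q of L has an element y of J in Q that avoids the
    other primes, if no element avoids them all.  For one prime P of L take such
    an x, and the product z of those for the other primes: then x^a + z^b avoids
    all the primes. *)
Lemma prime_avoidance J L : is_ideal J ->
  (exists2 y, H y & J y) ->
  (forall P, P \in L -> set_prime P /\ exists2 y, H y & J y /\ ~ P y) ->
  exists2 y, H y & J y /\ forall P, P \in L -> ~ P y.
Proof.
move=> hJ hy0; have [n] := ubnP (size L); elim: n L => // n IH [|P L] sL h.
  by have [y Hy Jy] := hy0; exists y => //.
have step Q : Q \in P :: L -> exists2 y, H y &
    J y /\ forall R, R \in rem Q (P :: L) -> ~ R y.
  move=> QL; apply: IH; first by rewrite size_rem.
  by move=> R /mem_rem; apply: h.
apply: contrapT => no.
have step' Q : Q \in P :: L -> exists2 y, H y &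
    [/\ J y, Q y & forall R, R \in rem Q (P :: L) -> ~ R y].
  move=> QL; have [y Hy [Jy hR]] := step Q QL; exists y => //; split=> //.
  apply: contrapT => nQy; apply: no; exists y => //; split=> // R.
  by have /perm_mem-> := perm_to_rem QL; rewrite inE => /orP[/eqP->//|/hR].
have [pP [y0 Hy0 [Jy0 nPy0]]] := h P (mem_head _ _).
have [x Hx [Jx Px hx]] := step' P (mem_head _ _).
move: hx; rewrite /= eqxx => hx.
have [PL|nPL] := boolP (P \in L).
  apply: no; exists x => //; split=> // R; rewrite inE => /orP[/eqP->|]; exact: hx.
have [z Hz [nPz Lz]] : exists2 z, H z & ~ P z /\ forall Q, Q \in L -> Q z.
  have : forall Q, Q \in L -> exists2 y, H y & Q y /\ ~ P y.
    move=> Q QL; have QL' : Q \in P :: L by rewrite inE QL orbT.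
    have [y Hy [Jy Qy hR]] := step' Q QL'; exists y => //; split=> //.
    apply: hR => /=; case: eqP => [e|_]; last exact: mem_head.
    by rewrite e QL in nPL.
  have : forall Q, Q \in L -> is_ideal Q.
    move=> Q QL; have QL' : Q \in P :: L by rewrite inE QL orbT.
    by have [[]] := h Q QL'.
  elim: (L) => [|Q K IHK] hid hK; first by exists y0.
  have [||z Hz [nPz hz]] := IHK.
  - by move=> R RK; apply: hid; rewrite inE RK orbT.
  - by move=> R RK; apply: hK; rewrite inE RK orbT.
  have [y Hy [Qy nPy]] := hK Q (mem_head _ _).
  exists (y * z); first exact: H_mul.
  split=> [|R]; first exact: primeNM.
  rewrite inE => /orP[/eqP->|RK].
    by apply: is_idealMr => //; apply: hid; rewrite mem_head.
  by apply: is_idealMl; [apply: hid; rewrite inE RK orbT|apply: hz].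
have [a [b [a0 b0 Hab]]] := H_add Hx (H_mul Hz Hy0).
have pow I (y : A) k : is_ideal I -> (0 < k)%N -> I y -> I (y ^+ k).
  by case: k => // k hI _ Iy; rewrite exprS; apply: is_idealMr.
apply: no; exists (x ^+ a + (z * y0) ^+ b) => //; split.
  by apply: is_idealD => //; apply: pow => //; apply: is_idealMl.
move=> R; rewrite inE => /orP[/eqP->|RL].
  have hP : is_ideal P by case: pP.
  move=> /(is_idealB hP)/(_ (pow _ _ _ hP a0 Px)); rewrite addrAC subrr add0r.
  by apply: primeNX => //; apply: primeNM.
have [pR _] : set_prime R /\ exists2 y, H y & J y /\ ~ R y.
  by apply: h; rewrite inE RL orbT.
have hR : is_ideal R by case: pR.
have Rz : R ((z * y0) ^+ b) by apply: pow => //; apply: is_idealMr => //; apply: Lz.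
move=> /(is_idealB hR)/(_ Rz); rewrite addrK.
by apply: primeNX => //; apply: hx.
Qed.
End Avoidance.

(** * Krull's intersection, principal ideal and height theorems *)

Section Krull.
Variables (A : comNzRingType) (noeA : noetherian A).
Implicit Types (I J P Q : set A).

(** A colon ideal (J : b) is prime when it is maximal among those with b outside J. *)
Lemma colon_prime J : is_ideal J -> ~ J 1 ->
  exists2 b, ~ J b & set_prime [set z | J (z * b)].
Proof.
move=> hJ nJ1.
pose F := [set I | is_ideal I /\ exists2 b, ~ J b & I = [set z | J (z * b)]].
have hcol b : is_ideal [set z | J (z * b)].
  split=> /= [|x y Jx Jy|a x Jx]; first by rewrite mul0r; apply: is_ideal0.
    by rewrite mulrDl; apply: is_idealD.
  by rewrite -mulrA; apply: is_idealMl.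
have [I [//]||I [hI [b nJb eI]] [_ mx]] := @noeth_max _ F [set z | J (z * 1)] noeA.
  by split=> //; exists 1.
exists b => //; split=> //=; first by rewrite mul1r.
move=> x y Jxy; have [Jyb|nJyb] := pselect (J (y * b)); [by right|left].
have := mx [set z | J (z * (y * b))]; rewrite eI; apply.
- by split=> //; exists (y * b).
- by move=> z /= Jz; rewrite mulrCA; apply: is_idealMl.
- by rewrite /= mulrA.
Qed.

Lemma ideal_exp1E (m : idealr A) x : x \in m -> ideal_exp m 1 x.
Proof.
move=> xm; apply: sub_gen_smallest; exists [tuple x]; last by rewrite big_seq1.
by move=> z; rewrite inE => /eqP->.
Qed.

Lemma ideal_expX (m : idealr A) d x k :
  ideal_exp m d x -> ideal_exp m (d * k) (x ^+ k).
Proof.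
move=> hx; elim: k => [|k IH]; first by rewrite muln0 ideal_exp0.
by rewrite mulnS exprS; apply: ideal_expM.
Qed.

Lemma ideal_exp_pow (m : idealr A) x k : x \in m -> ideal_exp m k (x ^+ k).
Proof. by move=> /ideal_exp1E h; have := @ideal_expX m 1 x k h; rewrite mul1n. Qed.

Lemma ideal_exp_sub_radical (m : idealr A) J : is_ideal J ->
  (forall x, x \in m -> exists n, J (x ^+ n)) ->
  exists N, ideal_exp m N `<=` J.
Proof.
move=> hJ h; have [N hN] := power_sub_radical noeA (I := [set` m]) hJ h.
exists N; apply: smallest_sub => // _ [t /= tm <-].
by apply: hN => [x /tm|]; last exact: size_tuple.
Qed.

(** If z is outside J, let K be maximal among the ideals containing J but not z.
    By maximality, x z is in K for x in m, and every ideal larger than K contains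
    z.  If x^n is outside K, then z = r x^n modulo K, so r x^(n+1) is in K;
    when the ideals (K : x^n) have become stationary, r x^n is in K as well, and
    so is z, which is absurd.  Hence a power of m is contained in K, and z is in
    K after all. *)
Lemma krull_intersection (m : idealr A) J z :
  (forall a, a \notin m -> exists u, u * a = 1) -> is_ideal J ->
  (forall k, exists2 x, ideal_exp m k x & J (z - x)) -> J z.
Proof.
move=> mU hJ hz; apply: contrapT => nJz.
have [I []|//|K [hK nKz] [JK mx]] :=
  @noeth_max _ [set K | is_ideal K /\ ~ K z] J noeA; first by [].
have out a : ~ K a -> adjoin K a z.
  move=> nKa; apply: contrapT => nz; apply: nKa.
  apply: (mx (adjoin K a)); first by split=> //; apply: adjoin_ideal.
    exact: adjoin_sub.
  exact: adjoin_self.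
have [x xm|N mK] := @ideal_exp_sub_radical m K hK; last first.
  by apply: nKz; have [x /mK Kx /JK] := hz N; move=> /(is_idealD hK)/(_ Kx); rewrite subrK.
have Kxz : K (x * z).
  apply: contrapT => /out[r hr]; apply: nKz.
  have /mU[u hu] : 1 - r * x \notin m.
    apply/negP => h; have := rpredD h (idealMr r xm).
    by rewrite subrK idealr1.
  by rewrite -[z]mul1r -hu -mulrA; apply: is_idealMl => //; move: hr; congr K; ring.
have [||n hn] := @noeth_chain _ (fun n => [set r | K (r * x ^+ n)]) noeA.
- move=> n; split=> /= [|a b Ka Kb|a b Kb]; first by rewrite mul0r; apply: is_ideal0.
    by rewrite mulrDl; apply: is_idealD.
  by rewrite -mulrA; apply: is_idealMl.
- by move=> n r /= Kr; rewrite exprS mulrCA; apply: is_idealMl.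
exists n; apply: contrapT => /out[r hr]; apply: nKz.
have : K (r * x ^+ n.+1).
  have -> : r * x ^+ n.+1 = x * z - x * (z - r * x ^+ n) by rewrite exprS; ring.
  by apply: is_idealB => //; apply: is_idealMl.
by move=> /(hn n.+1) /= Kr; rewrite -(subrK (r * x ^+ n) z); apply: is_idealD.
Qed.

(** Nakayama's lemma localized at P, stated in A itself: the factors s are the
    denominators.  The generators are eliminated one after another. *)
Lemma local_nakayama P (K : set A) (l : seq A) : set_prime P -> is_ideal K ->
  (forall a, a \in l -> exists s k b, [/\ ~ P s, K k, lspan P l b & s * a = k + b]) ->
  forall a, a \in l -> exists2 s, ~ P s & K (s * a).
Proof.
move=> pP hK; have [hP nP1 _] := pP; elim: l => // g l IH h.
have [s [k [_ [nPs Kk [c [b [Pc Sb ->]]] e]]]] := h g (mem_head _ _).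
have e1 : (s - c) * g = k + b.
  by transitivity (s * g - c * g); [ring|rewrite e; ring].
have nPsc : ~ P (s - c) by move=> Psc; apply: nPs; rewrite -(subrK c s); apply: is_idealD.
have {}IH : forall a, a \in l -> exists2 s, ~ P s & K (s * a).
  apply: IH => a al; have al' : a \in g :: l by rewrite inE al orbT.
  have [s' [k' [_ [nPs' Kk' [c' [b' [Pc' Sb' ->]]] e']]]] := h a al'.
  exists ((s - c) * s'), ((s - c) * k' + c' * k), ((s - c) * b' + c' * b).
  split; first exact: primeNM.
  - by apply: is_idealD => //; apply: is_idealMl.
  - apply: add_closedD; first by apply: lspan_add_closed; apply: ideal_add.
      by apply: (lspan_mull (M := P)) => [x Px|//]; exact: is_idealMl.
    by apply: (lspan_mull (M := P)) => [x Px|//]; exact: is_idealMl.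
  - transitivity ((s - c) * (s' * a)); first ring.
    transitivity ((s - c) * k' + c' * ((s - c) * g) + (s - c) * b').
      by rewrite e'; ring.
    by rewrite e1; ring.
move=> a; rewrite inE => /orP[/eqP->|]; last exact: IH.
have [t nPt Kt] : exists2 t, ~ P t & K (t * b).
  elim: l b Sb IH {h e e1} => [|y l IHl] b /=.
    by move=> -> _; exists 1 => //; rewrite mulr0; apply: is_ideal0.
  move=> [u [r [Pu Sr ->]]] IH.
  have [||t nPt Kt] := IHl r; [by []|by move=> z zl; apply: IH; rewrite inE zl orbT|].
  have [t' nPt' Kt'] := IH y (mem_head _ _).
  exists (t * t'); first exact: primeNM.
  have -> : t * t' * (u * y + r) = t * u * (t' * y) + t' * (t * r) by ring.
  by apply: is_idealD => //; apply: is_idealMl.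
exists (t * (s - c)); first exact: primeNM.
by rewrite -mulrA e1 mulrDr; apply: is_idealD => //; apply: is_idealMl.
Qed.
End Krull.

Section Height.
Variables (A : comNzRingType) (noeA : noetherian A).
Implicit Types (I J P Q : set A).

(** For y in Q outside Q0 let I_n be the set of the a such that a power of x times
    a is, locally at P, in Q0 + (y^n).  Modulo x the descending chain I_n stabilizes
    locally at P, because P is the only prime between Q0 + (x) and P.  As x is a
    nonzerodivisor modulo I_n, this means I_n = I_(n+1) + x I_n, so
    I_n = I_(n+1) by Nakayama's lemma.  So s x^j y^n = t y^(n+1) modulo Q0 with s
    outside P, and s x^j is in (y) + Q0, hence in Q, which is absurd.

    The symbolic powers of Q in the usual proof are replaced by the I_n, for which
    no localization has to be constructed. *)
Lemma principal_ideal_theorem Q0 Q P x : set_prime Q0 -> set_prime Q ->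
  set_prime P -> Q0 `<=` Q -> Q `<=` P -> P x ->
  (forall P', set_prime P' -> Q0 `<=` P' -> P' x -> P' `<=` P -> P `<=` P') ->
  ~ P `<=` Q -> Q `<=` Q0.
Proof.
move=> pQ0 pQ pP Q0Q QP Px mP nPQ y Qy; apply: contrapT => nQ0y.
have hQ0 : is_ideal Q0 by case: pQ0.
have hP : is_ideal P by case: pP.
have hQ : is_ideal Q by case: pQ.
have nP1 : ~ P 1 by case: pP.
have nQx : ~ Q x by move=> Qx; apply: nPQ; apply: mP.
pose In n := [set a | exists s k t, ~ P s /\ Q0 (s * x ^+ k * a - t * y ^+ n)].
have hIn n : is_ideal (In n).
  split=> /= [|a b [s [k [t [nPs h]]]] [s' [k' [t' [nPs' h']]]]|c a [s [k [t [nPs h]]]]].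
  - by exists 1, 0%N, 0; split=> //; rewrite mulr0 mul0r subrr; apply: is_ideal0.
  - exists (s * s'), (k + k')%N, (s' * x ^+ k' * t + s * x ^+ k * t').
    split; first exact: primeNM.
    have := is_idealD hQ0 (is_idealMl (s' * x ^+ k') hQ0 h) (is_idealMl (s * x ^+ k) hQ0 h').
    by congr Q0; rewrite exprD; ring.
  - exists s, k, (c * t); split=> //.
    by have := is_idealMl c hQ0 h; congr Q0; ring.
have Insat n s a : ~ P s -> In n (s * a) -> In n a.
  move=> nPs [s' [k [t [nPs' h]]]]; exists (s' * s), k, t.
  by split; [exact: primeNM|move: h; congr Q0; ring].
have InS n : In n.+1 `<=` In n.
  move=> a [s [k [t [nPs h]]]]; exists s, k, (t * y); split=> //.
  by move: h; congr Q0; rewrite exprS; ring.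
have Q0In n : Q0 `<=` In n.
  move=> a Q0a; exists 1, 0%N, 0; split=> //.
  by rewrite mul0r subr0; apply: is_idealMl.
pose St k a := exists s b r, [/\ ~ P s, In k.+1 b & s * a = b + r * x].
have Stsat k s a : ~ P s -> St k (s * a) -> St k a.
  move=> nPs [s' [b [r [nPs' h e]]]]; exists (s' * s), b, r.
  by split=> //; [exact: primeNM|rewrite -mulrA].
have StD k a a' : St k a -> St k a' -> St k (a + a').
  move=> [s [b [r [nPs h e]]]] [s' [b' [r' [nPs' h' e']]]].
  exists (s * s'), (s' * b + s * b'), (s' * r + s * r').
  split; first exact: primeNM.
    by apply: is_idealD => //; apply: is_idealMl.
  transitivity (s' * (s * a) + s * (s' * a')); first ring.
  by rewrite e e'; ring.
(* Stability modulo x of the chain cut down by J is propagated from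
   J = Q0 + (x) to J = A: if b is outside J and (J : b) is prime, then (J : b) is
   P, and J + (b) adds one composition factor, which the decreasing ideals In
   either all meet or eventually all miss. *)
have main : forall J, is_ideal J -> (forall s a, ~ P s -> J (s * a) -> J a) ->
    Q0 `<=` J -> J x ->
    (exists k0, forall k a, (k0 <= k)%N -> In k a -> J a -> St k a) ->
    exists k, forall a, In k a -> St k a.
  apply: (noeth_ind noeA) => J hJ IH Jsat Q0J Jx [k0 hk0].
  have [J1|nJ1] := pselect (J 1).
    by exists k0 => a Ia; apply: hk0 => //; rewrite -[a]mulr1; apply: is_idealMl.
  have [b nJb pb] := colon_prime noeA hJ nJ1.
  have PJb r : P r -> J (r * b).
    move: r; apply: (mP [set z | J (z * b)]) => //=.
    - by move=> a Q0a; apply: is_idealMr => //; apply: Q0J.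
    - exact: is_idealMr.
    - by move=> z Jzb; apply: contrapT => /Jsat/(_ Jzb).
  pose J' := [set z | exists s r, ~ P s /\ J (s * z - r * b)].
  have JJ' : J `<=` J'.
    by move=> a Ja; exists 1, 0; split=> //; rewrite mul1r mul0r subr0.
  apply: (IH J') => //.
  - split=> [|a a' [s [r [nPs h]]] [s' [r' [nPs' h']]]|c a [s [r [nPs h]]]].
    + by apply: JJ'; apply: is_ideal0.
    + exists (s * s'), (s' * r + s * r'); split; first exact: primeNM.
      have := is_idealD hJ (is_idealMl s' hJ h) (is_idealMl s hJ h').
      by congr J; ring.
    + by exists s, (c * r); split=> //; have := is_idealMl c hJ h; congr J; ring.
  - move=> /(_ b); apply: contra_not nJb; apply.
    by exists 1, 1; split=> //; rewrite subrr; apply: is_ideal0.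
  - move=> s a nPs [s' [r [nPs' h]]]; exists (s' * s), r.
    by split; [exact: primeNM|rewrite -mulrA].
  - by move=> a /Q0J/JJ'.
  - exact: JJ'.
  - have [[k1 hk1]|no] := pselect (exists k1, forall a, In k1 a -> J' a -> J a).
      exists (maxn k0 k1) => k a; rewrite geq_max => /andP[k0k k1k] Ia J'a.
      apply: hk0 => //; apply: hk1 => //.
      have mono : forall i, In (i + k1)%N `<=` In k1.
        by elim=> [//|i IHi] z /InS/IHi.
      by apply: (mono (k - k1)%N); rewrite subnK.
    exists k0 => k z k0k Iz [s [r [nPs h]]].
    have /existsNP[w /not_implyP[Iw /not_implyP[[s' [r' [nPs' h']]] nJw]]] :
        ~ forall a, In k.+1 a -> J' a -> J a by apply: contra_not no => h0; exists k.+1.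
    have nPr' : ~ P r'.
      move=> /PJb Jr'b; apply: nJw; apply: (Jsat s') => //.
      by rewrite -(subrK (r' * b) (s' * w)); apply: is_idealD.
    apply: (Stsat _ (r' * s)); first exact: primeNM.
    have -> : r' * s * z = (r' * s * z - r * s' * w) + r * s' * w by ring.
    apply: StD; last first.
      exists 1, (r * s' * w), 0; split=> //; last by rewrite mul1r mul0r addr0.
      exact: is_idealMl.
    apply: hk0 => //.
      by apply: is_idealB => //; [exact: is_idealMl|apply: InS; exact: is_idealMl].
    have := is_idealB hJ (is_idealMl r' hJ h) (is_idealMl r hJ h').
    by congr J; ring.
have [k hk] : exists k, forall a, In k a -> St k a.
  apply: (main [set a | exists s r, ~ P s /\ Q0 (s * a - r * x)]).
  - split=> [|a a' [s [r [nPs h]]] [s' [r' [nPs' h']]]|c a [s [r [nPs h]]]].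
    + by exists 1, 0; split=> //; rewrite mulr0 mul0r subrr; apply: is_ideal0.
    + exists (s * s'), (s' * r + s * r'); split; first exact: primeNM.
      have := is_idealD hQ0 (is_idealMl s' hQ0 h) (is_idealMl s hQ0 h').
      by congr Q0; ring.
    + by exists s, (c * r); split=> //; have := is_idealMl c hQ0 h; congr Q0; ring.
  - move=> s a nPs [s' [r [nPs' h]]]; exists (s' * s), r.
    by split; [exact: primeNM|rewrite -mulrA].
  - by move=> a Q0a; exists 1, 0; split=> //; rewrite mul1r mul0r subr0.
  - by exists 1, 1; split=> //; rewrite subrr; apply: is_ideal0.
  - exists 0%N => k a _ Ia [s [r [nPs h]]].
    exists s, (s * a - r * x), r; split=> //; first exact: Q0In.
    by rewrite subrK.
have [l el] := noeA (hIn k).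
have Isub : In k `<=` In k.+1.
  have h : forall a, a \in l -> In k.+1 a.
    move=> a al.
    have [|s nPs h] := local_nakayama pP (hIn k.+1) (l := l) _ al; last exact: Insat h.
    move=> {al}a al; have Ia : In k a by rewrite el; apply: sub_gen_smallest.
    have [s [b [r [nPs Ib e]]]] := hk a Ia.
    exists s, b, (r * x); split=> //; rewrite mulrC.
    apply: (lspan_mull (M := setT)); first by move=> c _; apply: is_idealMr.
    rewrite -ideal_genE -el.
    have [s' [j [t [nPs' h]]]] : In k (r * x).
      have -> : r * x = s * a - b by rewrite e; ring.
      by apply: is_idealB => //; [exact: is_idealMl|exact: InS].
    exists s', j.+1, t; split=> //.
    by move: h; congr Q0; rewrite exprS; ring.
  by rewrite {1}el ideal_genE; apply: lspan_le_ideal.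
have [s [j [t [nPs h]]]] : In k.+1 (y ^+ k).
  apply: Isub; exists 1, 0%N, 1; split=> //.
  by rewrite expr0 !mul1r subrr; apply: is_ideal0.
have [_ _ Q0M] := pQ0.
have [Q0yk|Q0s] : Q0 (y ^+ k) \/ Q0 (s * x ^+ j - t * y).
  by apply: Q0M; move: h; congr Q0; rewrite exprS; ring.
- exact: (nQ0y (primeX pQ0 Q0yk)).
- have : Q (s * x ^+ j).
    rewrite -(subrK (t * y) (s * x ^+ j)); apply: is_idealD => //.
      exact: Q0Q.
    exact: is_idealMl.
  by apply: primeNM => //; [move=> /QP|exact: primeNX].
Qed.

(** Only C 0, ..., C n matter. *)
Definition set_prime_chain n (C : nat -> set A) : Prop :=
  (forall i, (i <= n)%N -> set_prime (C i)) /\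
  forall i, (i < n)%N -> C i `<=` C i.+1 /\ ~ C i.+1 `<=` C i.

(** Let P1 be maximal among the primes below P that contain the previous member of
    the chain, and f in l outside P1.  As P is minimal over P1 + (f), the other
    elements g of l satisfy s g^k = h + c f with h in P1 and s outside P.  By the
    principal ideal theorem P1 is minimal over the elements h, which are one
    less in number. *)
Lemma krull_height (l : seq A) P n C : minimal_over (lspan setT l) P ->
  set_prime_chain n C -> C n `<=` P -> (n <= size l)%N.
Proof.
elim: n l P => // n IH l P [pP lP mP] [pC sC] CP.
have [CnS nCS] := sC n (leqnn _).
have nPCn : ~ P `<=` C n by move=> PC; apply: nCS => x /CP/PC.
have [I [] //||P1 [_ [pP1 P1P nPP1]] [CP1 mP1]] := @noeth_max _
  [set Q | is_ideal Q /\ [/\ set_prime Q, Q `<=` P & ~ P `<=` Q]] (C n) noeA.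
  have pCn : set_prime (C n) by apply: pC.
  by split; [case: pCn|split=> // x /CnS/CP].
have hP1 : is_ideal P1 by case: pP1.
have [f fl nP1f] : exists2 f, f \in l & ~ P1 f.
  apply: contrapT => no; apply: nPP1; apply: mP => //.
  apply: lspan_le_ideal => // y yl; apply: contrapT => nP1y.
  by apply: no; exists y.
have Pf : P f by apply: lP; apply: mem_lspan.
have mPf : minimal_over (adjoin P1 f) P.
  split=> //; first by apply: adjoin_le => //; case: pP.
  move=> P' pP' h P'P; apply: contrapT => nPP'.
  apply: nP1f; apply: (mP1 P'); first by split; [case: pP'|].
    by move=> x P1x; apply: h; apply: adjoin_sub.
  by apply: h; apply: adjoin_self.
have /choice[h hh] : forall g, exists h, g \in l -> P1 h /\
    exists s k c, ~ P s /\ s * g ^+ k = h + c * f.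
  move=> g; have [gl|ngl] := boolP (g \in l); last by exists 0.
  have [s [k [nPs [c hc]]]] := minimal_over_zdiv noeA (adjoin_ideal f hP1) mPf
    (lP _ (mem_lspan gl)).
  exists (s * g ^+ k - c * f) => _; split=> //.
  by exists s, k, c; rewrite subrK.
have rl g : g \in rem f l -> g \in l by apply: mem_rem.
rewrite -(prednK (n := size l)); last by case: (l) fl.
rewrite -(size_rem fl) -(size_map h); apply: (IH _ P1) => //.
  split=> //.
    by apply: lspan_le_ideal => // _ /mapP[g /rl/hh[P1h _] ->].
  move=> Q0 pQ0 hQ0 Q0P1.
  apply: (principal_ideal_theorem pQ0 pP1 pP Q0P1 P1P Pf) => //.
  move=> P' pP' Q0P' P'f P'P; apply: mP => //.
  have hP' : is_ideal P' by case: pP'.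
  apply: lspan_le_ideal => // g.
  rewrite (perm_mem (perm_to_rem fl)) inE => /orP[/eqP->//|gl].
  have [_ [s [k [c [nPs e]]]]] := hh g (rl g gl).
  apply: contrapT => nP'g.
  suff : P' (s * g ^+ k) by apply: primeNM => //; [move=> /P'P|exact: primeNX].
  rewrite e; apply: is_idealD => //; last exact: is_idealMl.
  by apply: Q0P'; apply: hQ0; apply: mem_lspan; apply: map_f.
by split=> i hi; [apply: pC; apply: leqW|apply: sC; apply: leqW].
Qed.

End Height.


(** * Regular sequences *)

Section Regular.
Variables (A : comNzRingType) (S : set A).
Hypothesis hS : is_subring S.
Implicit Types (l : seq A).

(** The head of l is the last element of the sequence.  Regularity is relative to
    a subring S: multiplication by the head is injective on S modulo the ideal
    of S spanned by the tail. *)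
Fixpoint regular_seq (S : set A) l : Prop :=
  if l is x :: l' then
    regular_seq S l' /\ forall a, S a -> lspan S l' (x * a) -> lspan S l' a
  else True.

Let S0 : S 0. Proof. by case: hS. Qed.
Let S1 : S 1. Proof. by case: hS. Qed.
Let SM x y : S x -> S y -> S (x * y). Proof. by case: hS => _ _ _; apply. Qed.
Let SB x y : S x -> S y -> S (x - y). Proof. by case: hS => _ _ + _; apply. Qed.
Let SX x k : S x -> S (x ^+ k).
Proof. by move=> Sx; elim: k => [|k IH]; rewrite ?expr0 // exprS; apply: SM. Qed.
Let hSa : add_closed S := subring_add hS.

Let span_add l : add_closed (lspan S l). Proof. exact: lspan_add_closed. Qed.

Let spanM l a x : S a -> lspan S l x -> lspan S l (a * x).
Proof. by move=> Sa; apply: (lspan_mull (M := S)) => b Sb; apply: SM. Qed.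

Lemma lspan_middle l1 y l : lspan S (l1 ++ y :: l) = lspan S (y :: l1 ++ l).
Proof.
by apply: eq_mem_lspan => // z; rewrite !(mem_cat, inE) orbCA.
Qed.

(** A member of a regular sequence stays a nonzerodivisor modulo the others when
    it is moved to the end; this needs no finiteness, unlike
    [regular_perm]. *)
Lemma regular_seq_middle l1 y l : (forall z, z \in l1 ++ y :: l -> S z) ->
  regular_seq S (l1 ++ y :: l) ->
  forall a, S a -> lspan S (l1 ++ l) (y * a) -> lspan S (l1 ++ l) a.
Proof.
elim: l1 => [|x l1 IH] lS /=; first by case.
have lS' z : z \in l1 ++ y :: l -> S z by move=> zl; apply: lS; rewrite inE zl orbT.
have Sx : S x by apply: lS; rewrite mem_head.
have Sy : S y by apply: lS'; rewrite mem_cat mem_head orbT.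
move=> [/(IH lS') reg hx] a Sa [b [r [Sb Sr e]]].
have : lspan S (l1 ++ y :: l) (x * b).
  rewrite lspan_middle; exists a, (- r); split=> //; first exact: add_closedN.
  by rewrite mulrC [a * y]mulrC e; ring.
move=> /(hx _ Sb); rewrite lspan_middle => -[c [t [Sc St eb]]].
have Sr' : lspan S (l1 ++ l) (a - c * x).
  apply: reg; first by apply: SB => //; apply: SM.
  have -> : y * (a - c * x) = x * t + r by rewrite mulrBr e eb; ring.
  by apply: add_closedD => //; apply: spanM.
by exists c, (a - c * x); split=> //; ring.
Qed.

(** If x a = b y^(e+1) modulo l, then a = a' y modulo l, and y can be cancelled. *)
Lemma nzd_mod_pow l x y e : S x -> S y -> (forall z, z \in l -> S z) ->
  (forall a, S a -> lspan S l (y * a) -> lspan S l a) ->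
  (forall a, S a -> lspan S (y :: l) (x * a) -> lspan S (y :: l) a) ->
  forall a, S a -> lspan S (y ^+ e :: l) (x * a) -> lspan S (y ^+ e :: l) a.
Proof.
move=> Sx Sy lS hy hx; elim: e => [|e IH] a Sa.
  by exists a, 0; split=> //; [case: (span_add l)|rewrite expr0; ring].
move=> [b [t [Sb St e1]]].
have [a' [r [Sa' Sr ea]]] : lspan S (y :: l) a.
  apply: hx => //; exists (b * y ^+ e), t.
  by split=> //; [apply: SM => //; apply: SX|rewrite e1 exprS; ring].
have [c [u [Sc Su ea']]] : lspan S (y ^+ e :: l) a'.
  apply: IH => //; exists b, (x * a' - b * y ^+ e); split=> //; last by ring.
  apply: hy; first by apply: SB; apply: SM => //; apply: SX.
  have -> : y * (x * a' - b * y ^+ e) = t - x * r.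
    transitivity (x * a - x * r - b * y ^+ e.+1); first by rewrite ea exprS; ring.
    by rewrite e1; ring.
  by apply: (span_add l).2 => //; apply: spanM.
exists c, (y * u + r); split=> //.
  by apply: add_closedD => //; apply: spanM.
by rewrite ea ea' exprS; ring.
Qed.

Lemma regular_seq_pow1 l1 y l e : (forall z, z \in l1 ++ y :: l -> S z) ->
  regular_seq S (l1 ++ y :: l) -> regular_seq S (l1 ++ y ^+ e :: l).
Proof.
elim: l1 => [|x l1 IH] lS.
  move=> [reg hy]; split=> //; elim: e => [|e IHe] a Sa; first by rewrite expr0 mul1r.
  have Sy : S y by apply: lS; rewrite mem_head.
  rewrite exprS -mulrA => /hy/(IHe _ Sa); apply; apply: SM => //; exact: SX.
have lS' z : z \in l1 ++ y :: l -> S z by move=> zl; apply: lS; rewrite inE zl orbT.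
move=> /= [reg hx]; split; first exact: IH.
move=> a Sa; rewrite lspan_middle; apply: nzd_mod_pow => //.
- by apply: lS; rewrite mem_head.
- by apply: lS'; rewrite mem_cat mem_head orbT.
- move=> z; rewrite mem_cat => h; apply: lS'.
  by rewrite mem_cat inE; case/orP: h => ->; rewrite ?orbT.
- exact: regular_seq_middle.
- by move=> b Sb; rewrite -lspan_middle; apply: hx.
Qed.

Lemma regular_seq_pow l e : (forall z, z \in l -> S z) ->
  regular_seq S l -> regular_seq S (map (fun x => x ^+ e) l).
Proof.
suff h l1 l2 : (forall z, z \in l1 ++ l2 -> S z) -> regular_seq S (l1 ++ l2) ->
    regular_seq S (l1 ++ map (fun x => x ^+ e) l2) by apply: (h [::]).
elim: l2 l1 => //= y l2 IH l1 lS reg.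
have := IH (rcons l1 y); rewrite !cat_rcons => /(_ lS reg).
apply: regular_seq_pow1 => z; rewrite mem_cat inE => /or3P[zl|/eqP->|/mapP[x xl ->]].
- by apply: lS; rewrite mem_cat zl.
- by apply: lS; rewrite mem_cat mem_head orbT.
- by apply: SX; apply: lS; rewrite mem_cat inE xl !orbT.
Qed.

End Regular.

Section RegularNoetherian.
Variables (A : comNzRingType) (noeA : noetherian A).
Implicit Types (l : seq A).
Local Notation regular := (regular_seq setT).

(** An element of a minimal prime over an ideal is a zero divisor modulo it, up to
    powers. *)
Lemma nzd_notin_minimal l x Q : minimal_over (lspan setT l) Q ->
  (forall a, lspan setT l (x * a) -> lspan setT l a) -> ~ Q x.
Proof.
move=> mQ nzd Qx.
have [s [k [nQs h]]] := minimal_over_zdiv noeA (lspan_ideal l) mQ Qx.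
apply: nQs; have [_ lQ _] := mQ; apply: lQ; elim: k h => [|k IH].
  by rewrite expr0 mulr1.
by rewrite exprS mulrCA => /nzd.
Qed.

(** A lower bound on the height of the ideal generated by l, in a form that can be
    extended one element at a time. *)
Definition height_ge_size l : Prop := forall Q, set_prime Q ->
  lspan setT l `<=` Q -> exists C, set_prime_chain (size l) C /\ C (size l) = Q.

Lemma height_ge_size_cons x l : height_ge_size l ->
  (forall Q, minimal_over (lspan setT l) Q -> ~ Q x) -> height_ge_size (x :: l).
Proof.
move=> hl nx Q pQ lQ; have hS : add_closed (@setT A) by [].
have [|Q' mQ' Q'Q] := exists_minimal_le noeA (lspan_ideal l) pQ.
  by move=> y yl; apply: lQ; apply: lspan_cons.
have [pQ' lQ' _] := mQ'.
have [C [[pC sC] eC]] := hl Q' pQ' lQ'.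
exists (fun i => if (i <= size l)%N then C i else Q); split; last by rewrite ltnn.
split=> [i _|i il]; first by case: ifP => // /pC.
have [->|ne] := eqVneq i (size l); last first.
  have {ne}il : (i < size l)%N by rewrite ltn_neqAle ne.
  by rewrite /= il (ltnW il); apply: sC.
rewrite /= leqnn ltnn eC; split=> // QQ'; apply: (nx Q' mQ'); apply: QQ'; apply: lQ.
by apply: (@mem_lspan _ (x :: l)); rewrite mem_head.
Qed.

Lemma regular_height l : regular l -> height_ge_size l.
Proof.
elim: l => [|x l IH] /=.
  by move=> _ Q pQ _; exists (fun=> Q); split=> //; split.
move=> [/IH hl nzd]; apply: height_ge_size_cons => // Q mQ.
by apply: nzd_notin_minimal mQ _ => a; apply: nzd.
Qed.

Section Local.
Variable m : idealr A.
Hypothesis mU : forall a, a \notin m -> exists u, u * a = 1.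

(** If x a is in (l), then a = y a' modulo l with x a' in (l) again; repeating
    this, a is in (l) + (y^k) for all k. *)
Lemma nzd_swap l y : y \in m ->
  forall x, (forall a, lspan setT l (y * a) -> lspan setT l a) ->
  (forall a, lspan setT (y :: l) (x * a) -> lspan setT (y :: l) a) ->
  forall a, lspan setT l (x * a) -> lspan setT l a.
Proof.
move=> ym x hy hx a0 ha0.
have hl : add_closed (@setT A) by [].
have hI := lspan_ideal l.
apply: (krull_intersection noeA mU) => // k.
suff [b hb] : exists b, lspan setT l (a0 - y ^+ k * b) /\ lspan setT l (x * b).
  exists (y ^+ k * b); last by case: hb.
  by rewrite mulrC; apply: (is_idealMl b (ideal_exp_ideal m k)); apply: ideal_exp_pow.
elim: k => [|k [b [h1 h2]]].
  by exists a0; rewrite expr0 mul1r subrr; split=> //; apply: is_ideal0.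
have [c [r [_ Sr eb]]] := hx b (lspan_cons y hl h2).
exists c; split.
  have -> : a0 - y ^+ k.+1 * c = (a0 - y ^+ k * b) + y ^+ k * r by rewrite eb exprS; ring.
  by apply: is_idealD => //; apply: is_idealMl.
apply: hy; have -> : y * (x * c) = x * b - x * r by rewrite eb; ring.
by apply: is_idealB => //; apply: is_idealMl.
Qed.

Lemma regular_swap l x y : y \in m -> regular (x :: y :: l) -> regular (y :: x :: l).
Proof.
move=> ym reg; have [[regl hy] hx] := reg.
split; first split=> //.
  by move=> a _; apply: (nzd_swap ym) => b; [apply: hy|apply: hx].
move=> a _; apply: (@regular_seq_middle _ setT _ [:: x] y l) => //.
Qed.

Lemma regular_to_front l1 x l : (forall y, y \in l1 ++ x :: l -> y \in m) ->
  regular (l1 ++ x :: l) -> regular (x :: l1 ++ l).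
Proof.
elim: l1 => // y l1 IH lm /= [/IH reg hy].
apply: regular_swap; first by apply: lm; rewrite mem_cat mem_head orbT.
split; first by apply: reg => z zl; apply: lm; rewrite inE zl orbT.
move=> a _; have -> : lspan setT (x :: l1 ++ l) = lspan setT (l1 ++ x :: l).
  by rewrite lspan_middle.
exact: hy.
Qed.

Lemma regular_perm l l' : (forall y, y \in l -> y \in m) -> perm_eq l l' ->
  regular l -> regular l'.
Proof.
elim: l' l => [|x l' IH] l lm pe; first by move=> _.
have xl : x \in l by rewrite (perm_mem pe) mem_head.
case/splitPr: xl lm pe => l1 l2 lm pe reg.
have pe' : perm_eq (l1 ++ l2) l'.
  by rewrite -(perm_cons x); apply: perm_trans pe; rewrite perm_sym (perm_catCA l1 [:: x] l2).
have [reg' hx] := regular_to_front lm reg.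
split.
  apply: (IH (l1 ++ l2)) => // y; rewrite mem_cat => h; apply: lm.
  by rewrite mem_cat inE; case/orP: h => ->; rewrite ?orbT.
have <- // : lspan setT (l1 ++ l2) = lspan setT l'.
by apply: eq_mem_lspan => //; apply: perm_mem.
Qed.

End Local.
End RegularNoetherian.


(** * Noetherian local rings and localization *)

Section PrimeSets.
Variable A : comNzRingType.
Implicit Types (I P : set A).

Lemma idealr_is_ideal (m : idealr A) : is_ideal [set` m].
Proof. by split=> [|x y|a x] /=; [exact: idealr0|exact: rpredD|exact: idealMr]. Qed.

Lemma prime_idealr_set_prime (P : prime_idealr A) : set_prime [set` P].
Proof.
split; [exact: idealr_is_ideal|by rewrite /= idealr1|].
by move=> a b /=; rewrite prime_idealrM => /orP.
Qed.

Lemma idealr_closed_set I : is_ideal I -> ~ I 1 -> idealr_closed (fun x => `[< I x >]).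
Proof.
move=> hI nI1; split; first by apply/asboolP; apply: is_ideal0.
  by apply/negP => /asboolP.
move=> a u v /asboolP Iu /asboolP Iv; apply/asboolP; apply: is_idealD => //.
exact: is_idealMl.
Qed.

Lemma exists_idealr I : is_ideal I -> ~ I 1 -> exists J : idealr A, [set` J] = I.
Proof.
move=> hI nI1; pose f x := `[< I x >].
pose J : idealr A := HB.pack f (isIdealr.Build A f (idealr_closed_set hI nI1)).
by exists J; apply/seteqP; split=> x /asboolP.
Qed.

Lemma exists_prime_idealr P : set_prime P -> exists Q : prime_idealr A, [set` Q] = P.
Proof.
move=> [hP nP1 PM]; pose f x := `[< P x >].
have fM : prime_idealr_closed f.
  by move=> u v /asboolP/PM[h|h]; apply/orP; [left|right]; apply/asboolP.
pose Q : prime_idealr A := HB.pack f (isIdealr.Build A f (idealr_closed_set hP nP1))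
  (isPrimeIdealrClosed.Build A f fM).
by exists Q; apply/seteqP; split=> x /asboolP.
Qed.

Lemma prime_chain_set n (C : nat -> prime_idealr A) : prime_chain n C ->
  set_prime_chain n (fun i => [set` C i]).
Proof.
by move=> h; split=> [i _|i /h//]; apply: prime_idealr_set_prime.
Qed.

Lemma set_chain_prime n C : set_prime_chain n C ->
  exists C' : nat -> prime_idealr A, prime_chain n C' /\ [set` C' n] = C n.
Proof.
move=> [pC sC].
have [Qn _] := exists_prime_idealr (pC n (leqnn n)).
have /choice[C' hC'] : forall i, exists Q : prime_idealr A, (i <= n)%N -> [set` Q] = C i.
  move=> i; have [/pC/exists_prime_idealr[Q e]|] := boolP (i <= n)%N; first by exists Q.
  by exists Qn.
exists C'; split; last exact: hC'.
move=> i il; have := sC i il; rewrite -(hC' i (ltnW il)) -(hC' i.+1 il).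
by [].
Qed.

End PrimeSets.

Section LocalRing.
Variables (B : comNzRingType) (noeB : noetherian B) (m : idealr B).
Hypothesis mU : forall a, a \notin m -> exists u, u * a = 1.

Lemma proper_sub_max I : is_ideal I -> ~ I 1 -> I `<=` [set` m].
Proof.
move=> hI nI1 x Ix; apply/negPn/negP => /mU[u e]; apply: nI1.
by rewrite -e; apply: is_idealMl.
Qed.

Lemma units_local_ring : local_ring m.
Proof.
split=> [J mJ x xJ|m' maxm'].
  apply: (@proper_sub_max [set` J]) => //; first exact: idealr_is_ideal.
  by rewrite /= idealr1.
have sub : {subset m' <= m}.
  move=> x; apply: (@proper_sub_max [set` m']); first exact: idealr_is_ideal.
  by rewrite /= idealr1.
by move=> x; apply/idP/idP; [exact: sub|exact: maxm'].
Qed.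

Lemma max_set_prime : set_prime [set` m].
Proof.
split; [exact: idealr_is_ideal|by rewrite /= idealr1|] => a b /= ab.
have [am|/mU[u e]] := boolP (a \in m); [by left|right].
by rewrite -[b]mul1r -e -mulrA idealMr.
Qed.

Lemma radical_max l : (forall y, y \in l -> y \in m) ->
  (forall Q, set_prime Q -> lspan setT l `<=` Q -> [set` m] `<=` Q) ->
  radical (ideal_gen [set` l]) = [set` m].
Proof.
move=> lm h; rewrite ideal_genE; apply/seteqP; split=> [x [n hx]|x xm].
  apply: (primeX max_set_prime (n := n)); move: hx.
  by apply: lspan_le_ideal; [exact: idealr_is_ideal|exact: lm].
apply: (radical_primes noeB (lspan_ideal l)) => Q pQ lQ.
exact: h.
Qed.

(** The number of generators of m bounds the length of the chains of primes. *)
Lemma local_krull_dim : exists d, krull_dim B d.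
Proof.
have [l el] := noeB (idealr_is_ideal m); rewrite ideal_genE in el.
have mm : minimal_over (lspan setT l) [set` m].
  by rewrite -el; split=> //; exact: max_set_prime.
have bound n C : @prime_chain B n C -> (n <= size l)%N.
  move=> /prime_chain_set h; apply: (krull_height noeB mm h) => /=.
  apply: (@proper_sub_max [set` C n]); first exact: idealr_is_ideal.
  by rewrite /= idealr1.
have ex0 : exists n, `[< exists C, @prime_chain B n C >].
  have [Q _] := exists_prime_idealr max_set_prime.
  by exists 0%N; apply/asboolP; exists (fun=> Q).
have bd n : `[< exists C, @prime_chain B n C >] -> (n <= size l)%N.
  by move=> /asboolP[C]; apply: bound.
case: (ex_maxnP ex0 bd) => d /asboolP hd mx; exists d; split=> // n C hC.
by apply: mx; apply/asboolP; exists C.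
Qed.

(** While some prime containing l is not m, add an element of m that avoids the
    minimal primes over l: this raises the height bound, so it stops after at
    most d steps.  If less than d elements suffice, zeros make up the number. *)
Lemma extend_to_sop l d : krull_dim B d -> (forall y, y \in l -> y \in m) ->
  height_ge_size l -> exists t, system_of_parameters (l ++ t).
Proof.
move=> [dC dim]; have [k] := ubnP (d - size l); elim: k l => // k IH l sk lm hl.
have lsub : lspan setT l `<=` [set` m].
  by apply: lspan_le_ideal; [exact: idealr_is_ideal|exact: lm].
have ld : (size l <= d)%N.
  have [C [/set_chain_prime[C' [hC' _]] _]] := hl _ max_set_prime lsub.
  exact: dim hC'.
have [h|/existsNP[Q /not_implyP[pQ /not_implyP[lQ nmQ]]]] := pselect
    (forall Q, set_prime Q -> lspan setT l `<=` Q -> [set` m] `<=` Q).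
  exists (nseq (d - size l) 0); exists m.
  rewrite size_cat size_nseq subnKC //.
  split=> //; first exact: units_local_ring.
  apply: radical_max => [y|R pR lR].
    by rewrite mem_cat mem_nseq => /orP[/lm//|/andP[_ /eqP->]]; apply: idealr0.
  apply: h => // y; move=> ly; apply: lR.
  by apply: lspan_subseq ly => // z zl; rewrite mem_cat zl.
have [L [hL pL]] := minimal_primes noeB (lspan_ideal l).
have [||||a _ [am nL]] := @prime_avoidance B setT _ _ [set` m] L (idealr_is_ideal m).
- by [].
- by move=> x y _ _; exists 1%N, 1%N.
- by exists 0 => //; apply: idealr0.
- move=> P /hL[pP lP mP]; split=> //.
  have [P1 nP1 _] := pP.
  have Pm := proper_sub_max P1 nP1.
  have /existsNP[y /not_implyP[ym nPy]] : ~ [set` m] `<=` P.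
    move=> mP'; apply: nmQ => y /mP'; apply: mP => // z Qz; apply: mP'.
    by have [Q1 nQ1 _] := pQ; apply: (proper_sub_max Q1 nQ1).
  by exists y.
have hal : height_ge_size (a :: l).
  apply: height_ge_size_cons => // P [pP lP mP].
  have [P' P'L P'P] := pL P pP lP.
  move=> Pa; apply: (nL P' P'L); apply: mP => //; have [] := hL P' P'L => //.
have hal_m y : y \in a :: l -> y \in m by rewrite inE => /orP[/eqP->//|/lm].
have al_d : (size l < d)%N.
  have [|C [/set_chain_prime[C' [hC' _]] _]] := hal _ max_set_prime.
    by apply: lspan_le_ideal; [exact: idealr_is_ideal|exact: hal_m].
  exact: dim hC'.
have [|t [m' [lm' dim' rad']]] := IH (a :: l) _ hal_m hal.
  by move: sk al_d => /=; move: (size l) => sl; lia.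
exists (a :: t), m'; split=> //.
  by move: dim'; rewrite /= !size_cat /= addnS.
rewrite -rad' !ideal_genE; congr radical; apply: eq_mem_lspan => // z.
by rewrite !(mem_cat, inE) orbCA orbA.
Qed.

End LocalRing.

Section Localization.
Variables (A : comNzRingType) (P : prime_idealr A).
Local Notation L := (localization P).
Local Notation loc := (to_localization P).

Lemma locD a b : loc (a + b) = loc a + loc b. Proof. exact: rmorphD. Qed.
Lemma locB a b : loc (a - b) = loc a - loc b. Proof. exact: rmorphB. Qed.
Lemma locM a b : loc (a * b) = loc a * loc b. Proof. exact: rmorphM. Qed.
Lemma loc0 : loc 0 = 0. Proof. exact: rmorph0. Qed.
Lemma loc1 : loc 1 = 1. Proof. exact: rmorph1. Qed.
Lemma locX a n : loc (a ^+ n) = loc a ^+ n. Proof. exact: rmorphXn. Qed.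

Lemma loc_frac (z : L) : exists a s, s \notin P /\ z * loc s = loc a.
Proof.
elim/quotW: z => -[a s]; exists a, (Localization.den s); split.
  exact: Localization.denP.
rewrite !piE.
by apply: (@Localization.eq_pi _ _ _ _ (Localization.denom1 P)) => /=; ring.
Qed.

Lemma loc_unit s : s \notin P -> exists u, u * loc s = 1.
Proof.
move=> sP; exists (\pi_L (1, Localization.Denom sP)).
rewrite !piE.
by apply: (@Localization.eq_pi _ _ _ _ (Localization.denom1 P)) => /=; ring.
Qed.

Lemma loc_eq0 a : loc a = 0 -> exists2 u, u \notin P & u * a = 0.
Proof.
move/eqP; rewrite -[0]loc0 !piE => /asboolP[u /=].
rewrite !mulr1 mulr0 => e; exists (Localization.den u) => //.
exact: Localization.denP.
Qed.

Lemma loc_eq a b : loc a = loc b -> exists2 u, u \notin P & u * a = u * b.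
Proof.
move=> e; have [|u uP h] := @loc_eq0 (a - b); first by rewrite locB e subrr.
by exists u => //; apply/eqP; rewrite -subr_eq0 -mulrBr h.
Qed.

Lemma notin_mul s s' : s \notin P -> s' \notin P -> s * s' \notin P.
Proof. by move=> sP sP'; rewrite prime_idealrM negb_or sP. Qed.

Lemma loc_noetherian : noetherian A -> noetherian L.
Proof.
move=> noeA I hI.
have hJ : is_ideal [set a | I (loc a)].
  split=> /= [|a b Ia Ib|a b Ib]; first by rewrite loc0; apply: is_ideal0.
    by rewrite locD; apply: is_idealD.
  by rewrite locM; apply: is_idealMl.
have [l el] := noeA _ hJ; exists (map loc l); rewrite ideal_genE.
apply/seteqP; split=> [z Iz|].
  have [a [s [sP e]]] := loc_frac z; have [u eu] := loc_unit sP.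
  have -> : z = u * loc a by rewrite -e mulrCA eu mulr1.
  apply: is_idealMl; first exact: lspan_ideal.
  have Ja : I (loc a) by rewrite -e; apply: is_idealMr.
  have {Ja} : [set a | I (loc a)] a := Ja.
  rewrite el ideal_genE; elim: (l) a {e} => [|y l' IH] a /=.
    by move=> ->; rewrite loc0.
  move=> [b [r [_ /IH Sr ->]]]; exists (loc b), (loc r).
  by rewrite locD locM.
apply: lspan_le_ideal => // _ /mapP[a al ->].
suff : [set a | I (loc a)] a by [].
by rewrite el; apply: sub_gen_smallest.
Qed.

Lemma loc_max : exists M : idealr L, (forall z, z \notin M -> exists u, u * z = 1) /\
  forall a, a \in P -> loc a \in M.
Proof.
have hI : is_ideal [set z | exists a s, [/\ a \in P, s \notin P & z * loc s = loc a]].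
  split.
  - by exists 0, 1; rewrite idealr0 idealr1 mul0r loc0.
  - move=> x y [a [s [aP sP e]]] [a' [s' [aP' sP' e']]].
    exists (s' * a + s * a'), (s * s'); split.
    + by apply: rpredD; apply: idealMr.
    + exact: notin_mul.
    + by rewrite locD !locM -e -e'; ring.
  - move=> z x [a [s [aP sP e]]]; have [b [t [tP e']]] := loc_frac z.
    exists (b * a), (t * s); split; [exact: idealMr|exact: notin_mul|].
    by rewrite !locM -e -e'; ring.
have nI1 : ~ [set z | exists a s, [/\ a \in P, s \notin P & z * loc s = loc a]] 1.
  move=> [a [s [aP sP]]]; rewrite mul1r => /loc_eq[u uP e].
  by have := notin_mul uP sP; rewrite e (idealMr _ aP).
have [M eM] := exists_idealr hI nI1; exists M; split=> [z|a aP].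
  have [a [s [sP e]]] := loc_frac z.
  move=> zM; have aP : a \notin P.
    apply/negP => aP; move/negP: zM; apply.
    by suff : [set` M] z by []; rewrite eM; exists a, s.
  have [u eu] := loc_unit aP; exists (u * loc s).
  by rewrite -mulrA [_ * z]mulrC e.
suff : [set` M] (loc a) by [].
by rewrite eM; exists a, 1; rewrite idealr1 loc1 mulr1.
Qed.

Lemma loc_lspan l (z : L) : lspan setT (map loc l) z ->
  exists s b, [/\ s \notin P, lspan setT l b & z * loc s = loc b].
Proof.
move: z; have hl := lspan_ideal l.
suff h : is_ideal [set z | exists s b, [/\ s \notin P, lspan setT l b & z * loc s = loc b]].
  apply: (lspan_le_ideal h) => _ /mapP[y yl ->].
  by exists 1, y; rewrite idealr1 loc1 mulr1; split=> //; apply: mem_lspan.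
split.
- by exists 1, 0; rewrite idealr1 mul0r loc0; split=> //; apply: is_ideal0.
- move=> x y [s [b [sP Sb e]]] [s' [b' [sP' Sb' e']]].
  exists (s * s'), (s' * b + s * b'); split; first exact: notin_mul.
    by apply: is_idealD => //; apply: is_idealMl.
  by rewrite locD !locM -e -e'; ring.
- move=> z x [s [b [sP Sb e]]]; have [c [t [tP e']]] := loc_frac z.
  exists (t * s), (c * b); split; [exact: notin_mul|exact: is_idealMl|].
  by rewrite !locM -e -e'; ring.
Qed.

Lemma lspan_loc l a : lspan setT l a -> lspan setT (map loc l) (loc a).
Proof.
elim: l a => [|y l IH] a /=; first by move=> ->; rewrite loc0.
move=> [b [r [_ /IH Sr ->]]]; exists (loc b), (loc r).
by rewrite locD locM.
Qed.

Lemma loc_regular l : regular_seq setT l -> regular_seq setT (map loc l).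
Proof.
elim: l => //= x l IH [/IH reg nzd]; split=> // z _ hz.
have [a [s [sP e]]] := loc_frac z.
have [t [b [tP Sb e']]] := loc_lspan hz.
(* x t a = s b in the localization, so u t a is in the ideal of l for some
   denominator u *)
have [|u uP eu] := @loc_eq (x * (t * a)) (s * b).
  by rewrite !locM -e -e'; ring.
have Sa : lspan setT l (u * t * a).
  apply: nzd => //; have -> : x * (u * t * a) = u * s * b.
    by transitivity (u * (x * (t * a))); [ring|rewrite eu; ring].
  by apply: is_idealMl => //; apply: lspan_ideal.
have [v ev] := loc_unit (notin_mul (notin_mul uP tP) sP).
have -> : z = v * loc (u * t * a).
  by rewrite -[z]mulr1 -ev !locM -e; ring.
by apply: is_idealMl; [exact: lspan_ideal|exact: lspan_loc].
Qed.

End Localization.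

(** Regular sequences localize, and over a local ring they extend to a system of
    parameters. *)
Lemma regular_parameters (A : comNzRingType) (l : seq A) :
  noetherian A -> regular_seq setT l -> parameters l.
Proof.
move=> noeA reg P lP.
have noeL := @loc_noetherian _ P noeA.
have [M [mU PM]] := loc_max P.
have [d dim] := local_krull_dim noeL mU.
apply: (extend_to_sop noeL mU dim).
  move=> _ /mapP[y yl ->]; apply: PM; apply: (lP y).
  exact: sub_gen_smallest.
by apply: regular_height => //; apply: loc_regular.
Qed.


(** * Tight closure of ideals generated by regular sequences *)

Section Frobenius.
Variables (A : comNzRingType) (p : nat).

Definition pow_seq q (l : seq A) : seq A := map (fun x => x ^+ q) l.

Lemma lspan_pow_frobenius_power q l :
  lspan setT (pow_seq q l) `<=` frobenius_power q (ideal_gen [set` l]).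
Proof.
apply: lspan_le_ideal; first exact: ideal_gen_ideal.
move=> _ /mapP[y yl ->]; apply: sub_gen_smallest; exists y => //.
exact: sub_gen_smallest.
Qed.

Lemma pchar_pow_nat e : p \in [pchar A] -> [pchar A].-nat (p ^ e)%N.
Proof. by move=> charp; rewrite pnatX pnatE ?charp // (pcharf_prime charp). Qed.

Lemma lspan_pow (charp : p \in [pchar A]) e l x :
  lspan setT l x -> lspan setT (pow_seq (p ^ e) l) (x ^+ (p ^ e)).
Proof.
have pc := pchar_pow_nat e charp.
elim: l x => [|y l IH] x /=.
  by move=> ->; rewrite expr0n; case: eqP => // /eqP; rewrite expn_eq0 (gtn_eqF (prime_gt0 (pcharf_prime charp))).
move=> [a [r [_ /IH Sr ->]]]; exists (a ^+ (p ^ e)), (r ^+ (p ^ e)).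
by rewrite exprDn_pchar // exprMn.
Qed.

Lemma frobenius_power_lspan (charp : p \in [pchar A]) e l :
  frobenius_power (p ^ e) (ideal_gen [set` l]) = lspan setT (pow_seq (p ^ e) l).
Proof.
apply/seteqP; split; last exact: lspan_pow_frobenius_power.
apply: smallest_sub; first exact: lspan_ideal.
by move=> _ [f /= fl <-]; apply: lspan_pow => //; rewrite -ideal_genE.
Qed.

Lemma minimal_prime_over (P : prime_idealr A) : minimal_prime P ->
  minimal_over (lspan setT [::]) [set` P].
Proof.
move=> mP; split; first exact: prime_idealr_set_prime.
  by move=> x /= ->; apply: idealr0.
move=> Q /exists_prime_idealr[Q' <-] _ Q'P.
exact: mP.
Qed.

Lemma frational_tight_closed l z c : F_rational A p -> regular_seq setT l ->
  (forall x, c * x = 0 -> x = 0) ->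
  (exists e0, forall e, (e0 <= e)%N ->
     lspan setT (pow_seq (p ^ e) l) (c * z ^+ (p ^ e))) ->
  lspan setT l z.
Proof.
move=> [_ noeA FR] reg nzd [e0 h].
rewrite -ideal_genE -(FR l); last exact: regular_parameters.
exists c; split.
  move=> P /minimal_prime_over mP; apply/negP => cP.
  by apply: (nzd_notin_minimal noeA (x := c) mP) => // x /= /nzd.
by exists e0 => e /h; apply: lspan_pow_frobenius_power.
Qed.

End Frobenius.

(** * Subrings generated by parameters, and free submodules *)

Section Adjunction.
Variables (G : comNzRingType) (K : set G).
Hypothesis hK : is_subring K.
Implicit Types (l : seq G) (P Q : set G).

(** The subring K[l] *)
Fixpoint gen_subring l : set G :=
  if l is y :: l' then
    [set x | exists2 f : {poly G}, (forall i, gen_subring l' f`_i) & x = f.[y]]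
  else K.

Lemma subring_sum (S : set G) n (F : 'I_n -> G) : is_subring S ->
  (forall i, S (F i)) -> S (\sum_(i < n) F i).
Proof.
move=> hS h; apply: big_ind => // [|x y Sx Sy]; first by case: hS.
by apply: add_closedD => //; apply: subring_add.
Qed.

Lemma gen_subring_subring l : is_subring (gen_subring l).
Proof.
elim: l => //= y l IH; have [S0 S1 SB SM] := IH; split.
- by exists 0; [move=> i; rewrite coef0|rewrite horner0].
- by exists 1; [move=> i; rewrite coef1; case: i|rewrite hornerC].
- move=> _ _ [f hf ->] [g hg ->]; exists (f - g); last by rewrite hornerD hornerN.
  by move=> i; rewrite coefB; apply: SB.
- move=> _ _ [f hf ->] [g hg ->]; exists (f * g); last by rewrite hornerM.
  by move=> i; rewrite coefM; apply: subring_sum => // j; apply: SM.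
Qed.

Lemma gen_subring_cons y l : gen_subring l `<=` gen_subring (y :: l).
Proof.
move=> x Sx; exists x%:P; last by rewrite hornerC.
have [S0 _ _ _] := gen_subring_subring l.
by move=> i; rewrite coefC; case: ifP.
Qed.

Lemma gen_subring_head y l : gen_subring (y :: l) y.
Proof.
exists 'X; last by rewrite hornerX.
have [S0 S1 _ _] := gen_subring_subring l.
by move=> i; rewrite coefX; case: (i == 1%N).
Qed.

Lemma gen_subring_catrev l l2 : gen_subring l2 `<=` gen_subring (catrev l l2).
Proof.
elim: l l2 => [|y l IH] l2 x hx //.
by apply: (IH (y :: l2)); apply: gen_subring_cons.
Qed.

Lemma gen_subring_mem l l2 y : y \in l -> gen_subring (catrev l l2) y.
Proof.
elim: l l2 => //= z l IH l2; rewrite inE => /orP[/eqP->|]; last exact: IH.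
by apply: gen_subring_catrev; apply: gen_subring_head.
Qed.

Lemma gen_subring_base l x : K x -> gen_subring l x.
Proof. by elim: l => //= y l IH /IH; apply: gen_subring_cons. Qed.

(** Take constant terms with respect to the elements of l. *)
Lemma gen_subring_decomp l l2 x : gen_subring (catrev l l2) x ->
  exists2 h, gen_subring l2 h & lspan (gen_subring (catrev l l2)) l (x - h).
Proof.
elim: l l2 x => [|y l IH] l2 x /=; first by exists x => //; rewrite subrr.
move=> /IH[_ [f hf ->] Sx].
have hS := gen_subring_subring (catrev l (y :: l2)).
exists f`_0 ; first exact: hf.
rewrite -(subrK f.[y] x) -addrA.
set S := gen_subring _ in hS Sx *.
elim/poly_ind: f hf Sx => [|f c _] hf Sx.
  exists 0, (x - (0 : {poly G}).[y]); split=> //; first by case: hS.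
  by rewrite horner0 coef0; ring.
exists f.[y], (x - (f * 'X + c%:P).[y]); split=> //.
  apply: gen_subring_catrev; exists f => // i.
  by have := hf i.+1; rewrite coefD coefMX coefC /= addr0.
by rewrite hornerMXaddC coefD coefMX coefC /=; ring.
Qed.

(** A chain of primes upwards from Q that meets the elements of l one at a time; it
    makes them algebraically independent over K modulo Q. *)
Fixpoint chain_through Q l : Prop :=
  if l is y :: l' then
    ~ Q y /\ exists Q', [/\ set_prime Q', Q `<=` Q', Q' y & chain_through Q' l']
  else True.

Hypothesis K_unit : forall x, K x -> x != 0 -> exists u, u * x = 1.

(** This is the algebraic independence of the elements of l modulo Q: in a
    polynomial in the head y of l with value in Q, the constant term is in Q'
    and so vanishes by induction; then y, which is not in Q, can be divided out. *)
Lemma gen_subring_meet Q l x : set_prime Q -> chain_through Q l ->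
  gen_subring l x -> Q x -> x = 0.
Proof.
elim: l Q x => [|y l IH] Q x pQ /=.
  move=> _ Kx Qx; apply/eqP/negPn/negP => /(K_unit Kx)[u e].
  by have [hQ nQ1 _] := pQ; apply: nQ1; rewrite -e; apply: is_idealMl.
move=> [nQy [Q' [pQ' QQ' Q'y ch]]] [f hf ->] {x}.
have [hQ _ QM] := pQ; have [hQ' _ _] := pQ'.
suff : Q f.[y] -> f = 0 by move=> h /h ->; rewrite horner0.
elim/poly_ind: f hf => // f c IHf hf; rewrite hornerMXaddC => Qf.
have hf' i : gen_subring l f`_i.
  by have := hf i.+1; rewrite coefD coefMX coefC /= addr0.
have c0 : c = 0.
  apply: (IH Q') => //.
    by have := hf 0%N; rewrite coefD coefMX coefC /= add0r.
  have -> : c = f.[y] * y + c - f.[y] * y by ring.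
  by apply: is_idealB => //; [exact: QQ'|exact: is_idealMl].
move: Qf; rewrite c0 !addr0 => /QM[/(IHf hf') ->|//].
by rewrite mul0r.
Qed.

(** As for [regular_seq], the head is the element chosen last. *)
Fixpoint avoiding l : Prop :=
  if l is y :: l' then
    avoiding l' /\ forall P, minimal_over (lspan setT l') P -> ~ P y
  else True.

Hypothesis domG : forall x y : G, x * y = 0 -> x = 0 \/ y = 0.
Hypothesis noeG : noetherian G.

(** K[l, l2] behaves as a polynomial ring in l over K[l2]: if y a is in (l) for
    the next element y, write a = h modulo l with h in K[y, l2]; then y h is in
    K[y, l2] and in a prime Q' containing l, so y h = 0 and h = 0. *)
Lemma gen_subring_regular l l2 Q : avoiding l -> minimal_over (lspan setT l) Q ->
  chain_through Q l2 -> regular_seq (gen_subring (catrev l l2)) l.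
Proof.
elim: l l2 Q => //= y l IH l2 Q [avl avy] [pQ lQ mQ] ch.
have [|Q' mQ' Q'Q] := exists_minimal_le noeG (lspan_ideal l) pQ.
  by move=> z zl; apply: lQ; apply: lspan_cons.
have [pQ' lQ' _] := mQ'.
have ch' : chain_through Q' (y :: l2).
  split; first exact: avy.
  exists Q; split=> //; apply: lQ; apply: (@mem_lspan _ (y :: l)).
  exact: mem_head.
split; first exact: (IH (y :: l2) Q').
set S := gen_subring _.
have hS : is_subring S by apply: gen_subring_subring.
have [_ _ _ SM] := hS.
have Sy : S y by apply: gen_subring_catrev; apply: gen_subring_head.
move=> a Sa hya; have [h Sh Sah] := gen_subring_decomp Sa.
suff h0 : h = 0 by rewrite -[a]subr0 -h0.
have [_ _ _ SMy] := gen_subring_subring (y :: l2).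
have : y * h = 0.
  apply: (gen_subring_meet pQ' ch'); first by apply: SMy => //; apply: gen_subring_head.
  apply: lQ'; apply: (@lspan_mono _ S); first by [].
  have -> : y * h = y * a - y * (a - h) by ring.
  apply: (lspan_add_closed l (subring_add hS)).2 => //.
  by apply: (lspan_mull (M := S)) => // b Sb; apply: SM.
case/domG => // y0; case: (avy Q' mQ'); rewrite y0.
by apply: is_ideal0; case: pQ'.
Qed.

Variable S : set G.
Hypothesis hS : is_subring S.

Fixpoint independent l : Prop :=
  if l is h :: l' then
    independent l' /\ forall a, S a -> lspan S l' (a * h) -> a = 0
  else True.

Let S0 : S 0. Proof. by case: hS. Qed.
Let S1 : S 1. Proof. by case: hS. Qed.
Let SM x y : S x -> S y -> S (x * y). Proof. by case: hS => _ _ _; apply. Qed.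
Let hSa : add_closed S := subring_add hS.
Let spanM l a x : S a -> lspan S l x -> lspan S l (a * x).
Proof. by move=> Sa; apply: (lspan_mull (M := S)) => b Sb; apply: SM. Qed.

(** A maximal independent subsequence hs of gs; every other g in gs satisfies a
    relation with a nonzero coefficient on g, and c is the product of these
    coefficients. *)
Lemma exists_independent gs : exists hs c, [/\ S c, c <> 0, independent hs &
  forall x, lspan S gs x -> lspan S hs (c * x)].
Proof.
elim: gs => [|g gs [hs [c [Sc c0 ind hc]]]].
  exists [::], 1; split=> //; first exact/eqP/oner_neq0.
  by move=> x /= ->; rewrite mulr0.
have [[a [Sa [a0 ha]]]|no] := pselect (exists a, S a /\ a <> 0 /\ lspan S hs (a * g)).
  exists hs, (a * c); split=> //; [exact: SM|by move=> /domG[]|].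
  move=> _ [b [r [Sb /hc Sr ->]]].
  have -> : a * c * (b * g + r) = c * b * (a * g) + a * (c * r) by ring.
  apply: add_closedD; first exact: lspan_add_closed.
    by apply: spanM => //; apply: SM.
  exact: spanM.
exists (g :: hs), c; split=> //.
  split=> // a Sa ha; apply: contrapT => a0; apply: no; by exists a.
move=> _ [b [r [Sb /hc Sr ->]]]; exists (c * b), (c * r).
by split=> //; [exact: SM|ring].
Qed.

(** A nonzerodivisor y on S/(l) is one on F/(l)F, for F the free S-module on hs:
    compare coefficients. *)
Lemma free_regular hs l y v : independent hs -> (forall z, z \in l -> S z) -> S y ->
  (forall a, S a -> lspan S l (y * a) -> lspan S l a) ->
  lspan S hs v -> lspan (lspan S hs) l (y * v) -> lspan (lspan S hs) l v.
Proof.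
elim: hs v => [|h hs IH] v ind lS Sy nzd.
  move=> /= -> _; elim: (l) => //= z l' IHl; exists 0, 0; split=> //.
  by rewrite mul0r addr0.
case: ind => ind hind [a [v' [Sa Sv' ->]]].
have decomp l' x : (forall z, z \in l' -> S z) -> lspan (lspan S (h :: hs)) l' x ->
    exists b w, [/\ lspan S l' b, lspan (lspan S hs) l' w & x = b * h + w].
  elim: l' x => [|z l' IHl] x l'S /=.
    by move=> ->; exists 0, 0; rewrite mul0r addr0.
  move=> [_ [r [[b [w [Sb Sw ->]]] Sr ->]]].
  have [|b' [w' [Sb' Sw' ->]]] := IHl r _ Sr.
    by move=> u ul; apply: l'S; rewrite inE ul orbT.
  exists (b * z + b'), (w * z + w'); split; last by ring.
    by exists b, b'.
  by exists w, w'.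
move=> /(decomp _ _ lS)[b [w [Sb Sw e]]].
have wS : lspan S hs w.
  move: w Sw {e}; apply: lspan_sub; first exact: lspan_add_closed.
  by move=> x z Sx /lS Sz; rewrite mulrC; apply: spanM.
have ya : y * a - b = 0.
  apply: hind; first by apply: hSa.2; [exact: SM|apply: (lspan_sub hSa _ Sb) => u z Su /lS; apply: SM].
  have -> : (y * a - b) * h = w - y * v'.
    apply/eqP; rewrite -subr_eq0; apply/eqP.
    transitivity (y * (a * h + v') - (b * h + w)); first ring.
    by rewrite e subrr.
  by apply: (lspan_add_closed hs hSa).2 => //; apply: spanM.
have Sla : lspan S l a by apply: nzd => //; move/eqP: ya; rewrite subr_eq0 => /eqP->.
have Slv' : lspan (lspan S hs) l v'.
  apply: IH => //; suff -> : y * v' = w by [].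
  apply/eqP; rewrite -subr_eq0; apply/eqP.
  transitivity (y * (a * h + v') - (b * h + w) - (y * a - b) * h); first ring.
  by rewrite e ya subrr mul0r subrr.
have hMa : add_closed (lspan S (h :: hs)) by apply: lspan_add_closed.
apply: add_closedD; first exact: lspan_add_closed.
  rewrite mulrC; apply: (lspan_mull (M := S)) Sla => u Su; rewrite mulrC.
  by apply: lspan_mem_mul => //; apply: mem_head.
by apply: lspan_mono Slv' => x; apply: lspan_cons.
Qed.

End Adjunction.


(** * F-rational graded rings *)

Section Graded.
Variables (G : comNzRingType) (pr : nat -> G -> G).
Implicit Types (I P Q : set G) (l : seq G).
(** A grading is given by the projections pr i on the components.  The component
    of degree 0 is a field by [pr_unit]. *)
Hypothesis prB : forall i x y, pr i (x - y) = pr i x - pr i y.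
Hypothesis pr_pr : forall i j x, pr i (pr j x) = if i == j then pr j x else 0.
Hypothesis pr_sum : forall x, exists n, x = \sum_(i < n) pr i x.
Hypothesis prM : forall n x y, pr n (x * y) = \sum_(i < n.+1) pr i x * pr (n - i) y.
Hypothesis pr1 : pr 0 1 = 1.
Hypothesis pr_unit : forall x, pr 0 x <> 0 -> exists u, u * pr 0 x = 1.

Let pr0 i : pr i 0 = 0.
Proof. by rewrite -{1}(subrr 0) prB subrr. Qed.
Let prN i x : pr i (- x) = - pr i x.
Proof. by rewrite -sub0r prB pr0 sub0r. Qed.
Let prD i x y : pr i (x + y) = pr i x + pr i y.
Proof. by rewrite -{1}[y]opprK prB prN opprK. Qed.

Lemma graded_mul_homog d n x y : pr d x = x ->
  pr n (x * y) = if (d <= n)%N then x * pr (n - d) y else 0.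
Proof.
move=> hx; rewrite prM.
have e (i : 'I_n.+1) : pr i x * pr (n - i) y = if i == d :> nat then x * pr (n - i) y else 0.
  by rewrite -hx pr_pr; case: eqP => [->|_]; rewrite ?mul0r ?hx.
rewrite (eq_bigr _ (fun i _ => e i)); case: leqP => dn.
  rewrite (bigD1 (Ordinal (dn : (d < n.+1)%N))) //= eqxx big1 ?addr0 // => i ni.
  by case: eqP => // ei; case/eqP: ni; apply: val_inj.
by rewrite big1 // => i _; case: eqP => // ei; have := ltn_ord i; rewrite ei ltnNge dn.
Qed.

Let pr_homM_deg d e x y : pr d x = x -> pr e y = y -> pr (d + e) (x * y) = x * y.
Proof. by move=> hx hy; rewrite (graded_mul_homog _ _ hx) leq_addr addKn hy. Qed.

Let pr_homX d x k : pr d x = x -> pr (d * k) (x ^+ k) = x ^+ k.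
Proof.
move=> hx; elim: k => [|k IH]; first by rewrite muln0 expr0 pr1.
by rewrite mulnS exprS; apply: pr_homM_deg.
Qed.

Definition pos_homog : set G := [set x | exists2 d, (0 < d)%N & pr d x = x].

Definition homog_ideal I : Prop := forall i x, I x -> I (pr i x).

Let irrelevant : set G := [set x | pr 0 x = 0].

Let pos_homog_mul x y : pos_homog x -> pos_homog y -> pos_homog (x * y).
Proof.
move=> [d d0 hx] [e e0 hy]; exists (d + e)%N; first by rewrite addn_gt0 d0.
exact: pr_homM_deg.
Qed.

Let pos_homog_add x y : pos_homog x -> pos_homog y ->
  exists a b, [/\ (0 < a)%N, (0 < b)%N & pos_homog (x ^+ a + y ^+ b)].
Proof.
move=> [d d0 hx] [e e0 hy]; exists e, d; split=> //.
exists (d * e)%N; first by rewrite muln_gt0 d0.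
by rewrite prD pr_homX // mulnC pr_homX.
Qed.

Let sum_in I x : is_ideal I -> (forall i, I (pr i x)) -> I x.
Proof. by move=> hI h; have [n ->] := pr_sum x; apply: is_ideal_sum. Qed.

Let homog_adjoin I a : homog_ideal I -> (exists d, pr d a = a) ->
  homog_ideal (adjoin I a).
Proof.
move=> hI [d ha] i x [r hr].
have [di|di] := boolP (d <= i)%N.
  exists (pr (i - d) r); have := hI i _ hr.
  by rewrite prB [r * a]mulrC (graded_mul_homog _ _ ha) di mulrC.
exists 0; have := hI i _ hr.
by rewrite prB [r * a]mulrC (graded_mul_homog _ _ ha) (negbTE di) mul0r.
Qed.

(** The product of the lowest components of a and b outside I is, modulo I, a
    component of a b. *)
Let homog_prime I : homog_ideal I -> is_ideal I -> ~ I 1 ->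
  (forall a b, (exists d, pr d a = a) -> (exists d, pr d b = b) ->
     I (a * b) -> I a \/ I b) -> set_prime I.
Proof.
move=> hh hI nI1 h; split=> // a b Iab.
apply: contrapT => /not_orP[nIa nIb].
have low x : ~ I x -> exists i, ~ I (pr i x) /\ forall j, (j < i)%N -> I (pr j x).
  move=> nIx; have ex : exists i, `[< ~ I (pr i x) >].
    have /existsNP[i hi] : ~ forall i, I (pr i x) by move/(sum_in hI).
    by exists i; apply/asboolP.
  case: (ex_minnP ex) => i /asboolP ni mn; exists i; split=> // j ji.
  by apply: contrapT => /asboolP /mn; rewrite leqNgt ji.
have [i [ni li]] := low a nIa; have [j [nj lj]] := low b nIb.
have : I (pr i a * pr j b).
  have := hh (i + j)%N _ Iab; rewrite prM.
  have iij : (i < (i + j).+1)%N by rewrite ltnS leq_addr.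
  rewrite (bigD1 (Ordinal iij)) //= addKn => hs.
  rewrite -[_ * _](addrK (\sum_(k < (i + j).+1 | k != Ordinal iij) pr k a * pr (i + j - k) b)).
  apply: is_idealB => //; apply: big_ind => [|x y|k ki]; first exact: is_ideal0.
    exact: is_idealD.
  have [kli|kgi|ei] := ltngtP k i; last by case/eqP: ki; apply: val_inj.
    by apply: is_idealMr => //; apply: li.
  apply: is_idealMl => //; apply: lj.
  by have := ltn_ord k; move: kgi; lia.
case/h; [by exists i; rewrite pr_pr eqxx|by exists j; rewrite pr_pr eqxx|exact: ni|exact: nj].
Qed.

Let homog_minimal_primes : noetherian G -> forall I, is_ideal I -> homog_ideal I ->
  exists L : seq (set G),
  (forall P, P \in L -> homog_ideal P /\ minimal_over I P) /\
  forall Q, set_prime Q -> I `<=` Q -> exists2 P, P \in L & P `<=` Q.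
Proof.
move=> noeG I hI hh.
exact: (@minimal_primes_class _ noeG homog_ideal [set x | exists d, pr d x = x]
  homog_adjoin homog_prime).
Qed.

Let irrelevant_ideal : is_ideal irrelevant.
Proof.
split=> [|x y hx hy|a x hx]; first exact: pr0.
  by rewrite /irrelevant /= prD hx hy addr0.
by rewrite /irrelevant /= prM big_ord_recl big_ord0 hx mulr0 addr0.
Qed.

Let homog_sub_irrelevant I : homog_ideal I -> is_ideal I -> ~ I 1 -> I `<=` irrelevant.
Proof.
move=> hh hI nI1 x Ix; apply: contrapT => /pr_unit[u e].
by apply: nI1; rewrite -e; apply: is_idealMl => //; apply: hh.
Qed.

Let irrelevant_homog : homog_ideal irrelevant.
Proof. by move=> i x hx; rewrite /irrelevant /= pr_pr; case: eqP => // <-. Qed.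

Let irrelevant_prime : set_prime irrelevant.
Proof.
split=> // [|a b].
  by rewrite /irrelevant /= pr1; apply/eqP/oner_neq0.
rewrite /irrelevant /= prM big_ord_recl big_ord0 addr0 subn0 => e.
have [|/pr_unit[u eu]] := pselect (pr 0 a = 0); [by left|right].
by rewrite -[pr 0 b]mul1r -eu -mulrA e mulr0.
Qed.

Let ideal_zero : is_ideal (lspan setT [::] : set G).
Proof. exact: lspan_ideal. Qed.

Section FRationalGraded.
Variable p : nat.
Hypothesis FR : F_rational G p.

Let charp : p \in [pchar G]. Proof. by case: FR. Qed.
Let noeG : noetherian G. Proof. by case: FR. Qed.
Let p_gt1 : (1 < p)%N. Proof. exact/prime_gt1/(pcharf_prime charp). Qed.
Let pe_gt0 e : (0 < p ^ e)%N. Proof. by rewrite expn_gt0 ltnW. Qed.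

(** A nilpotent element is in the tight closure of the ideal generated by the
    empty sequence. *)
Lemma frational_reduced (z : G) n : z ^+ n = 0 -> z = 0.
Proof.
move=> zn; suff : lspan setT [::] z by [].
apply: (@frational_tight_closed _ p [::] z 1) => //; first by move=> x; rewrite mul1r.
exists n => e ne /=; rewrite mul1r.
have : (n <= p ^ e)%N by apply: leq_trans ne _; apply: ltnW; apply: (ltn_expl _ p_gt1).
by move=> /subnK <-; rewrite exprD zn mulr0.
Qed.

(** Choose a homogeneous y in the annihilator of a that is in no minimal prime
    containing a; such a prime does not contain the annihilator of a, since G is
    reduced.  Then a + y is a nonzerodivisor, and a is in the tight closure of
    (a + y), hence a = al (a + y).  As G is reduced, (1 - al) a = 0 and
    al y = 0; comparing the lowest components, y = 0 as a <> 0, so a is a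
    nonzerodivisor. *)
Let homog_domain a b da : pr da a = a -> a * b = 0 -> a <> 0 -> b = 0.
Proof.
move=> ha ab a0.
have [da0|da0] := posnP da.
  have [u e] : exists u, u * pr 0 a = 1 by apply: pr_unit; rewrite -da0 ha.
  by rewrite -[b]mul1r -e -da0 ha -mulrA ab mulr0.
have hzero : homog_ideal (lspan setT [::]) by move=> i x /= ->.
have [L [hL pL]] := homog_minimal_primes noeG ideal_zero hzero.
pose Ann : set G := [set z | z * a = 0].
have hAnn : is_ideal Ann.
  split=> /= [|x y hx hy|c x hx]; rewrite /Ann /=; first by rewrite mul0r.
    by rewrite mulrDl hx hy addr0.
  by rewrite -mulrA hx mulr0.
have sq0 x : x * a * a = 0 -> x * a = 0.
  move=> h; apply: (frational_reduced (n := 2)).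
  by rewrite expr2 mulrACA -[RHS](mulr0 x) -h; ring.
have [y Hy [ya nLy]] : exists2 y, pos_homog y &
    Ann y /\ forall P, P \in [seq P <- L | `[< P a >]] -> ~ P y.
  apply: (prime_avoidance pos_homog_mul pos_homog_add hAnn).
    by exists 0; [exists 1%N|exact: is_ideal0].
  move=> P; rewrite mem_filter => /andP[/asboolP Pa /hL[hP mP]].
  have [pP _ _] := mP; split=> //; have [iP _ _] := pP.
  have [s [k [nPs sak]]] := minimal_over_zdiv noeG ideal_zero mP Pa.
  have sa : s * a = 0.
    apply: (frational_reduced (n := k.+1)); rewrite exprMn exprSr [in X in _ * X]exprSr.
    have -> : s ^+ k * s * (a ^+ k * a) = s ^+ k * a * (s * a ^+ k) by ring.
    by rewrite sak mulr0.
  have /existsNP[i nPi] : ~ forall i, P (pr i s) by move/(sum_in iP).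
  have pa : pr i s * a = 0.
    by have := graded_mul_homog (da + i) s ha; rewrite leq_addr addKn mulrC sa pr0 mulrC => <-.
  exists (pr i s); last by split.
  exists i; last by rewrite pr_pr eqxx.
  rewrite lt0n; apply/eqP => i0; rewrite i0 in pa nPi.
  have [u e] : exists u, u * pr 0 s = 1.
    by apply: pr_unit => ps0; apply: nPi; rewrite ps0; apply: is_ideal0.
  by apply: a0; rewrite -[a]mul1r -e -mulrA pa mulr0.
have nzd f : (a + y) * f = 0 -> f = 0.
  move=> h.
  have fa : f * a = 0.
    apply: sq0; have -> : f * a * a = (a + y) * f * a - y * a * f by ring.
    by rewrite h ya !mul0r subrr.
  have fy : f * y = 0 by have := h; rewrite mulrDl mulrC fa add0r mulrC.
  have [|n fn] := radical_primes noeG (a := f) ideal_zero; last exact: frational_reduced fn.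
  move=> P pP zP; have [P' P'L P'P] := pL P pP zP; apply: P'P.
  have [_ [[hP' _ PM] _ _]] := hL P' P'L.
  have [P'a|nP'a] := pselect (P' a); last first.
    by case: (PM f a) => //; rewrite fa; apply: is_ideal0.
  case: (PM f y) => //; first by rewrite fy; apply: is_ideal0.
  move=> P'y; case: (nLy P') => //; rewrite mem_filter P'L andbT; exact/asboolP.
have [al [r [_ r0 ea]]] : lspan setT [:: a + y] a.
  apply: (frational_tight_closed (c := a + y) FR) => //.
    split=> // x _ h; exact: nzd.
  exists 0%N => e _; exists a, 0; split=> //; rewrite addr0.
  have e1 k : a * (a + y) ^+ k = a ^+ k.+1.
    elim: k => [|k IH]; first by rewrite expr0 mulr1.
    by rewrite exprSr mulrA IH mulrDr exprSr -[_ * a * y]mulrA [a * y]mulrC ya mulr0 addr0 -!exprSr.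
  rewrite e1 mulrDl -exprS; case: (p ^ e)%N (pe_gt0 e) => // k _.
  by have -> : y * a ^+ k.+1 = 0; [rewrite exprS mulrA ya mul0r|rewrite addr0].
rewrite /= in r0; rewrite {r}r0 addr0 in ea.
have al1 : (1 - al) * a = 0.
  apply: sq0; have -> : (1 - al) * a * a = (a - al * (a + y)) * a + al * (y * a) by ring.
  by rewrite -ea subrr ya mul0r mulr0 addr0.
have aly : al * y = 0.
  have -> : al * y = al * (a + y) - a + (1 - al) * a by ring.
  by rewrite -ea subrr al1 addr0.
have pal : pr 0 al = 1.
  apply/eqP; rewrite eq_sym -subr_eq0 -{1}pr1 -prB; apply/negPn/negP => /eqP/pr_unit[u e].
  have := graded_mul_homog da (1 - al) ha; rewrite leqnn subnn mulrC al1 pr0 => h.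
  by apply: a0; rewrite -[a]mul1r -e -mulrA [_ * a]mulrC -h mulr0.
have y0 : y = 0.
  have [dy _ hy] := Hy.
  by have := graded_mul_homog dy al hy; rewrite leqnn subnn pal mulr1 mulrC aly pr0.
by apply: nzd; rewrite y0 addr0.
Qed.

Lemma frational_graded_domain (x y : G) : x * y = 0 -> x = 0 \/ y = 0.
Proof.
have [_ _ h] : set_prime (lspan setT [::] : set G).
  apply: homog_prime => //=; first by move=> i x' ->.
    by apply/eqP/oner_neq0.
  move=> a b [da ha] _ ab.
  have [|a0] := pselect (a = 0); [by left|right].
  exact: homog_domain ha ab a0.
exact: h.
Qed.

(** Add homogeneous elements of positive degree avoiding the minimal primes of the
    preceding ones, as long as the irrelevant ideal is not among these.  The ideals
    generated strictly increase, so this stops. *)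
Lemma exists_homog_system : exists l, [/\ forall y, y \in l -> pos_homog y, avoiding l &
  forall Q, set_prime Q -> lspan setT l `<=` Q -> irrelevant `<=` Q].
Proof.
suff h I : is_ideal I -> forall l, lspan setT l = I -> (forall y, y \in l -> pos_homog y) ->
    avoiding l -> exists l, [/\ forall y, y \in l -> pos_homog y, avoiding l &
    forall Q, set_prime Q -> lspan setT l `<=` Q -> irrelevant `<=` Q].
  by apply: (h _ ideal_zero [::]).
move: I; apply: (noeth_ind noeG) => I hI IH l el lH avl.
have [h|/existsNP[Q /not_implyP[pQ /not_implyP[lQ nGQ]]]] := pselect
    (forall Q, set_prime Q -> lspan setT l `<=` Q -> irrelevant `<=` Q).
  by exists l.
have hl : homog_ideal (lspan setT l).
  move=> i x; elim: l x lH {el avl lQ} => [|y l IHl] x lH /=; first by move=> ->.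
  move=> [a [r [_ Sr ->]]]; rewrite prD mulrC.
  have [d _ hy] := lH y (mem_head _ _); rewrite (graded_mul_homog _ _ hy).
  have Sr' : lspan setT l (pr i r) by apply: IHl => // z zl; apply: lH; rewrite inE zl orbT.
  case: ifP => _; last by exists 0, (pr i r); rewrite mul0r.
  by exists (pr (i - d) a), (pr i r); rewrite mulrC.
have [L [hL pL]] := homog_minimal_primes noeG (lspan_ideal l) hl.
have [||y Hy [_ nLy]] := prime_avoidance pos_homog_mul pos_homog_add (L := L) irrelevant_ideal.
- by exists 0; [exists 1%N|exact: is_ideal0].
- move=> P PL; have [hP [pP lP mP]] := hL P PL; split=> //.
  have [iP nP1 _] := pP.
  have /existsNP[x /not_implyP[Gx nPx]] : ~ irrelevant `<=` P.
    move=> GP; have [P' P'L P'Q] := pL Q pQ lQ; apply: nGQ => x /GP Px.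
    apply: P'Q; have [hP' [pP' lP' _]] := hL P' P'L; apply: mP => // {Px}x P'x.
    by apply: GP; have [iP' nP'1 _] := pP'; apply: (homog_sub_irrelevant hP' iP' nP'1).
  have /existsNP[i nPi] : ~ forall i, P (pr i x) by move/(sum_in iP).
  exists (pr i x); last by split=> //; apply: irrelevant_homog.
  exists i; last by rewrite pr_pr eqxx.
  by rewrite lt0n; apply/eqP => i0; apply: nPi; rewrite i0 Gx; apply: is_ideal0.
apply: (IH (lspan setT (y :: l)) _ _ _ (y :: l)) => //.
- exact: lspan_ideal.
- by rewrite -el => x; apply: lspan_cons.
- rewrite -el => /(_ y) h; have [P PL PQ] := pL Q pQ lQ.
  have [_ [_ lP _]] := hL P PL; apply: (nLy P PL); apply: lP; apply: h.
  by apply: mem_lspan; apply: mem_head.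
- by move=> z; rewrite inE => /orP[/eqP->//|]; apply: lH.
- split=> // P [pP lP mP] Py; have [P' P'L P'P] := pL P pP lP.
  have [_ [pP' lP' _]] := hL P' P'L.
  by apply: (nLy P' P'L); apply: mP.
Qed.

(** G_d is contained in the d-th power of the irrelevant ideal, as is the case for
    a ring generated by G_1 over G_0. *)
Hypothesis pr_gen : forall d I, is_ideal I ->
  (forall s : seq G, size s = d -> (forall y, y \in s -> pr 0 y = 0) -> I (\prod_(y <- s) y)) ->
  forall x, I (pr d x).

Let K : set G := [set x | pr 0 x = x].

Let hK : is_subring K.
Proof.
split=> [||x y hx hy|x y hx hy]; rewrite /K /=; [exact: pr0|exact: pr1| |].
  by rewrite prB hx hy.
by have := pr_homM_deg hx hy.
Qed.

Let K_unit x : K x -> x != 0 -> exists u, u * x = 1.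
Proof. by rewrite /K /= => hx x0; rewrite -hx; apply: pr_unit; rewrite hx; apply/eqP. Qed.

Let lspan_sum (M : set G) gs n (F : 'I_n -> G) : add_closed M ->
  (forall i, lspan M gs (F i)) -> lspan M gs (\sum_(i < n) F i).
Proof.
move=> hM h; have hs := lspan_add_closed gs hM.
by apply: big_ind => // [|x y]; [case: hs|exact: add_closedD].
Qed.

(** Each G_d has finite dimension over k = G_0: the components of degree d of
    generators of the ideal of elements of order at least d span it. *)
Let component_fin_gen d : exists gs, forall x, lspan K gs (pr d x).
Proof.
pose J : set G := [set x | forall i, (i < d)%N -> pr i x = 0].
have hJ : is_ideal J.
  split=> [i _|x y hx hy i id|a x hx i id]; first exact: pr0.
    by rewrite prD hx // hy // addr0.
  rewrite prM big1 // => k _; rewrite hx ?mulr0 //.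
  exact: leq_ltn_trans (leq_subr _ _) id.
have [gs egs] := noeG hJ; exists (map (pr d) gs) => x.
have gsJ y : y \in gs -> J y by move=> ygs; rewrite egs; apply: sub_gen_smallest.
have : J (pr d x) by move=> i id; rewrite pr_pr ltn_eqF.
rewrite egs ideal_genE.
suff h z : lspan setT gs z -> lspan K (map (pr d) gs) (pr d z).
  by move=> /h; rewrite pr_pr eqxx.
elim: gs z gsJ {egs} => [|y gs IH] z gsJ /=; first by move=> ->; exact: pr0.
move=> [a [r [_ Sr ->]]]; exists (pr 0 a), (pr d r); split.
- by rewrite /K /= pr_pr.
- by apply: IH => // u ugs; apply: gsJ; rewrite inE ugs orbT.
- rewrite prD; congr (_ + _); rewrite prM big_ord_recl /= subn0 big1 ?addr0 // => k _.
  rewrite (gsJ y (mem_head _ _)) ?mulr0 // /bump /=.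
  by have := ltn_ord k; lia.
Qed.

Let components_fin_gen n : exists gs, forall d x, (d < n)%N -> lspan K gs (pr d x).
Proof.
elim: n => [|n [gs IH]]; first by exists [::].
have [gs' h] := component_fin_gen n; exists (gs ++ gs') => d x.
have hKa := subring_add hK.
rewrite ltnS leq_eqVlt => /orP[/eqP->|dn].
  by apply: lspan_subseq (h x) => // z zg; rewrite mem_cat zg orbT.
by apply: lspan_subseq (IH d x dn) => // z zg; rewrite mem_cat zg.
Qed.

Section System.
Variable l : seq G.
Hypothesis lH : forall y, y \in l -> pos_homog y.
Hypothesis av : avoiding l.
Hypothesis lmax : forall Q, set_prime Q -> lspan setT l `<=` Q -> irrelevant `<=` Q.

Let pos_irrelevant y : pos_homog y -> irrelevant y.
Proof. by move=> [d d0 hy]; rewrite /irrelevant /= -hy pr_pr; case: eqP d0 => // <-. Qed.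

Lemma high_components_in_system : exists N, forall d x, (N <= d)%N -> lspan setT l (pr d x).
Proof.
have [N hN] : exists N, forall s : seq G, (forall x, x \in s -> irrelevant x) ->
    size s = N -> lspan setT l (\prod_(x <- s) x).
  apply: (power_sub_radical noeG (lspan_ideal l)) => a ha.
  by apply: (radical_primes noeG (lspan_ideal l)) => P pP lP; apply: lmax.
exists N => d x Nd; apply: pr_gen; first exact: lspan_ideal.
move=> s ss sI; rewrite -(cat_take_drop N s) big_cat /=.
apply: is_idealMr; first exact: lspan_ideal.
apply: hN; first by move=> y /mem_take/sI.
by rewrite size_takel // ss.
Qed.

Let S := gen_subring K (catrev l [::]).
Let hS : is_subring S. Proof. exact: gen_subring_subring. Qed.
Let hSa : add_closed S := subring_add hS.
Let SM x y : S x -> S y -> S (x * y). Proof. by case: hS => _ _ _; apply. Qed.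
Let lS y : y \in l -> S y. Proof. exact: gen_subring_mem. Qed.
Let spanM gs a x : S a -> lspan S gs x -> lspan S gs (a * x).
Proof. by move=> Sa; apply: (lspan_mull (M := S)) => b Sb; apply: SM. Qed.

(** G is spanned by its components of degree less than N, since those of degree
    at least N are in the ideal (l), and l has positive degrees. *)
Let finite_over : exists gs, forall x, lspan S gs x.
Proof.
have [N hN] := high_components_in_system; have [gs hgs] := components_fin_gen N.
exists gs; suff h d x : lspan S gs (pr d x).
  by move=> x; have [n ->] := pr_sum x; apply: lspan_sum.
have [k] := ubnP d; elim: k d x => // k IH d x; rewrite ltnS => dk.
have [dN|Nd] := ltnP d N.
  by apply: lspan_mono (hgs d x dN) => z; apply: gen_subring_base.
suff h l' z : {subset l' <= l} -> lspan setT l' z -> lspan S gs (pr d z).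
  have /h : {subset l <= l} by [].
  by move=> /(_ _ (hN d x Nd)); rewrite pr_pr eqxx.
elim: l' z => [|y l' IHl] z ll' /=.
  by move=> ->; rewrite pr0; case: (lspan_add_closed gs hSa).
move=> [a [r [_ Sr ->]]]; rewrite prD; apply: add_closedD.
- exact: lspan_add_closed.
- have yl : y \in l by apply: ll'; apply: mem_head.
  have [e e0 hy] := lH yl; rewrite mulrC (graded_mul_homog _ _ hy).
  case: ifP => [ed|_]; last by case: (lspan_add_closed gs hSa).
  apply: spanM; first exact: lS.
  by apply: IH; move: e0 ed dk; lia.
- by apply: IHl => // u ul; apply: ll'; rewrite inE ul orbT.
Qed.

(** Colon capturing: if x z is in (l'), then x^q z^q is in (l'^[q]).  Multiplying by
    c moves this into the free S-module spanned by hs, on which x^q is a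
    nonzerodivisor modulo l'^[q].  So c z^q is in (l'^[q]) and z in the tight
    closure of (l'). *)
Lemma homog_system_regular : regular_seq setT l.
Proof.
have domG := frational_graded_domain.
have irr_min : minimal_over (lspan setT l) irrelevant.
  split=> [|//|Q pQ lQ _]; last exact: lmax.
    exact: irrelevant_prime.
  by apply: lspan_le_ideal => // y /lH; apply: pos_irrelevant.
have regS : regular_seq S l.
  exact: (gen_subring_regular hK K_unit domG noeG av irr_min).
have [gs hgs] := finite_over.
have [hs [c [Sc c0 ind hc]]] := exists_independent domG hS gs.
have : forall y, y \in l -> S y by [].
elim: (l) regS => //= x l' IH [regS' nzdS] l'S.
have reg' : regular_seq setT l' by apply: IH => // y yl; apply: l'S; rewrite inE yl orbT.
split=> // z _ hz.
apply: (frational_tight_closed FR reg' (c := c)); first by move=> y /domG[].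
exists 0%N => e _; set q := (p ^ e)%N.
have := regular_seq_pow hS q l'S (conj regS' nzdS) => -[_ nzdq].
have l'qS u : u \in pow_seq q l' -> S u.
  move=> /mapP[y yl ->]; elim: q {nzdq} => [|q IHq]; first by rewrite expr0; case: hS.
  by rewrite exprS; apply: SM => //; apply: l'S; rewrite inE yl orbT.
have Sx : S (x ^+ q).
  elim: q {nzdq l'qS} => [|q IHq]; first by rewrite expr0; case: hS.
  by rewrite exprS; apply: SM => //; apply: l'S; apply: mem_head.
suff h : lspan (lspan S hs) (pow_seq q l') (c * z ^+ q) by apply: lspan_mono h.
apply: (free_regular hS ind l'qS Sx nzdq); first exact: hc.
rewrite mulrCA -exprMn; apply: (lspan_mull (M := setT)) (lspan_pow charp e hz) => a _.
exact: hc.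
Qed.

End System.

Lemma frational_homog_system : exists l,
  [/\ forall y, y \in l -> pos_homog y, regular_seq setT l &
      exists N, forall d x, (N <= d)%N -> lspan setT l (pr d x)].
Proof.
have [l [lH av lmax]] := exists_homog_system; exists l; split=> //.
  exact: homog_system_regular.
exact: high_components_in_system.
Qed.

End FRationalGraded.
End Graded.


(** * Initial forms in the associated graded ring *)

Section InitialForms.
Variables (R : comNzRingType) (m : idealr R).
Local Notation G := {ideal_quot (gr_idealr m)}.
Local Notation E := (ideal_exp m).

Let Eideal i : is_ideal (E i). Proof. exact: ideal_exp_ideal. Qed.
Let Eadd i : add_closed (E i). Proof. exact/ideal_add/Eideal. Qed.
Let E0 i : E i 0. Proof. exact: is_ideal0 (Eideal i). Qed.

Lemma ideal_exp_le i j x : (i <= j)%N -> E j x -> E i x.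
Proof. by move=> /subnK<-; elim: (j - i)%N => // k IH /ideal_expS/IH. Qed.

Lemma mono_rees_subproof i a : E i a -> a *: 'X^i \in rees_pred m.
Proof.
move=> h; apply/asboolP => j; rewrite coefZ coefXn.
by case: eqP => [->|_]; rewrite ?mulr1 ?mulr0.
Qed.

Definition mono_rees i a (h : E i a) : rees m := Rees (mono_rees_subproof h).

(** The class of a in m^i / m^(i+1); the value 0 for a outside m^i is not
    meaningful. *)
Definition init_form i a : G :=
  if pselect (E i a) is left h then \pi_G (mono_rees h) else 0.

Lemma init_formE i a (h : E i a) : init_form i a = \pi_G (mono_rees h).
Proof.
rewrite /init_form; case: pselect => // h'; congr (\pi_G _); exact: val_inj.
Qed.

Lemma gr_pi_eq (f g : rees m) :
  (forall i, E i.+1 ((val f)`_i - (val g)`_i)) -> \pi_G f = \pi_G g.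
Proof. by move=> h; apply/eqP/assoc_gradedP. Qed.

Lemma init_form_eq i a b : E i a -> E i b ->
  init_form i a = init_form i b <-> E i.+1 (a - b).
Proof.
move=> ha hb; rewrite !init_formE; split.
  by move=> /eqP/assoc_gradedP/(_ i); rewrite /= !coefZ coefXn eqxx !mulr1.
move=> h; apply: gr_pi_eq => j; rewrite /= !coefZ coefXn -mulrBl.
by case: eqP => [->|_]; rewrite ?mulr1 ?mulr0.
Qed.

Lemma init_form0 i : init_form i 0 = 0.
Proof.
rewrite (init_formE (@E0 i)) -[RHS](rmorph0 \pi_G); apply: gr_pi_eq => j /=.
by rewrite scale0r subrr.
Qed.

Lemma init_form_eq0 i a : E i a -> init_form i a = 0 <-> E i.+1 a.
Proof. by move=> ha; rewrite -(init_form0 i) init_form_eq // subr0. Qed.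

Lemma init_formB i a b : E i a -> E i b ->
  init_form i (a - b) = init_form i a - init_form i b.
Proof.
move=> ha hb; have hab := (Eadd i).2 _ _ ha hb.
rewrite !init_formE -rmorphB; apply: gr_pi_eq => j /=.
by rewrite scalerBl subrr.
Qed.

Lemma init_formD i a b : E i a -> E i b ->
  init_form i (a + b) = init_form i a + init_form i b.
Proof.
move=> ha hb; have hab := add_closedD (Eadd i) ha hb.
rewrite !init_formE -rmorphD; apply: gr_pi_eq => j /=.
by rewrite scalerDl subrr.
Qed.

Lemma init_formM i j a b : E i a -> E j b ->
  init_form (i + j) (a * b) = init_form i a * init_form j b.
Proof.
move=> ha hb; have hab := ideal_expM ha hb.
rewrite !init_formE -rmorphM; apply: gr_pi_eq => k /=.
by rewrite -scalerAl -scalerAr scalerA -exprD subrr.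
Qed.

Lemma init_form1 : init_form 0 1 = 1.
Proof.
have h : E 0 1 by rewrite ideal_exp0.
rewrite (init_formE h) -[RHS](rmorph1 \pi_G); apply: gr_pi_eq => k /=.
by rewrite scale1r expr0 subrr.
Qed.

Lemma init_formX i a n : E i a -> init_form (i * n) (a ^+ n) = init_form i a ^+ n.
Proof.
move=> ha; have hX k : E (i * k) (a ^+ k) by apply: ideal_expX.
elim: n => [|n IH]; first by rewrite muln0 !expr0 init_form1.
by rewrite mulnS !exprS init_formM // IH.
Qed.

Lemma init_form_sum i n (F : 'I_n -> R) : (forall k, E i (F k)) ->
  init_form i (\sum_(k < n) F k) = \sum_(k < n) init_form i (F k).
Proof.
elim: n F => [|n IH] F h; first by rewrite !big_ord0 init_form0.
rewrite !big_ord_recr /= init_formD // ?IH //.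
by apply: (is_ideal_sum _ (Eideal i)) => k; apply: h.
Qed.

(** The projection on m^i / m^(i+1). *)
Definition component i (x : G) : G := init_form i (val (repr x))`_i.

Lemma rees_coef (f : rees m) i : E i (val f)`_i.
Proof. by have /asboolP := valP f. Qed.

Lemma component_pi i f : component i (\pi_G f) = init_form i (val f)`_i.
Proof.
apply/init_form_eq; try exact: rees_coef.
by have /eqP/assoc_gradedP/(_ i) := reprK (\pi_G f).
Qed.

Lemma component_init_form i j a : E j a ->
  component i (init_form j a) = if i == j then init_form j a else 0.
Proof.
move=> ha; rewrite {1}(init_formE ha) component_pi /= coefZ coefXn.
by case: eqP => [->|_]; rewrite ?mulr1 // mulr0 init_form0.
Qed.

Lemma componentP i x : exists2 a, E i a & component i x = init_form i a.
Proof. by exists (val (repr x))`_i => //; apply: rees_coef. Qed.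

Lemma componentB i x y : component i (x - y) = component i x - component i y.
Proof.
elim/quotW: x => f; elim/quotW: y => g.
by rewrite -rmorphB !component_pi /= coefB init_formB //; apply: rees_coef.
Qed.

Lemma componentD i x y : component i (x + y) = component i x + component i y.
Proof. by rewrite -{2}[x](addrK y) componentB subrK. Qed.

Lemma component_component i j x :
  component i (component j x) = if i == j then component j x else 0.
Proof.
by have [a ha ->] := componentP j x; apply: component_init_form.
Qed.

Lemma component_sum x : exists n, x = \sum_(i < n) component i x.
Proof.
elim/quotW: x => f; exists (size (val f)).
rewrite (eq_bigr (fun i : 'I__ => \pi_G (mono_rees (@rees_coef f i)))); last first.
  by move=> i _; rewrite component_pi (init_formE (@rees_coef f i)).
rewrite -rmorph_sum; congr (\pi_G _); apply: val_inj.
by rewrite raddf_sum /= -[LHS]coefK poly_def.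
Qed.

Lemma componentM n x y :
  component n (x * y) = \sum_(i < n.+1) component i x * component (n - i) y.
Proof.
elim/quotW: x => f; elim/quotW: y => g.
rewrite -rmorphM component_pi /= coefM.
have h (i : 'I_n.+1) : (i + (n - i) = n)%N by rewrite subnKC // -ltnS.
rewrite init_form_sum => [|i]; last first.
  by rewrite -{1}(h i); apply: ideal_expM; apply: rees_coef.
apply: eq_bigr => i _; rewrite !component_pi -init_formM ?h //; exact: rees_coef.
Qed.

Lemma component1 : component 0 1 = 1.
Proof.
by rewrite -{1}init_form1 component_init_form ?init_form1 // ideal_exp0.
Qed.

Lemma component_unit : (forall a, a \notin m -> exists u, u * a = 1) ->
  forall x, component 0 x <> 0 -> exists u, u * component 0 x = 1.
Proof.
move=> mU x; have [a ha ->] := componentP 0 x => /init_form_eq0 h.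
have /mU[u e] : a \notin m by apply/negP => /ideal_exp1E; apply: h.
by exists (init_form 0 u); rewrite -init_formM ?ideal_exp0 // e init_form1.
Qed.

Lemma component_gen d (I : set G) : is_ideal I ->
  (forall s : seq G, size s = d -> (forall y, y \in s -> component 0 y = 0) ->
     I (\prod_(y <- s) y)) ->
  forall x, I (component d x).
Proof.
move=> hI h x; have [a ha ->] := componentP d x.
suff [] : E d a /\ I (init_form d a) by [].
move: a ha; apply: (@smallest_sub _ _ _ [set a | E d a /\ I (init_form d a)]).
  split.
  - by split=> //=; rewrite init_form0; apply: is_ideal0.
  - move=> y z [hy Iy] [hz Iz]; split; first exact: (add_closedD (Eadd d) hy hz).
    by rewrite init_formD //; apply: is_idealD.
  - move=> b y [hy Iy]; split; first exact: (is_idealMl b (Eideal d) hy).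
    by rewrite -[d]add0n init_formM ?ideal_exp0 //; apply: is_idealMl.
move=> _ [t /= tm <-].
have e (s : seq R) : {subset s <= m} -> E (size s) (\prod_(y <- s) y) /\
    init_form (size s) (\prod_(y <- s) y) = \prod_(y <- map (init_form 1) s) y.
  elim: s => [|y s IH] sm; first by rewrite !big_nil init_form1 ideal_exp0.
  have [hs es] := IH (fun z zs => sm z (mem_behead (s := y :: s) zs)).
  have hy : E 1 y by apply: ideal_exp1E; apply: sm; apply: mem_head.
  rewrite !big_cons -[size _]/(1 + size s)%N; split; first exact: ideal_expM.
  by rewrite init_formM // es.
have [ht et] := e t tm; rewrite size_tuple in ht et; split=> //.
rewrite et; apply: h; first by rewrite size_map size_tuple.
move=> _ /mapP[y yt ->].
have hy : E 1 y by apply: ideal_exp1E; apply: tm.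
by rewrite component_init_form.
Qed.

End InitialForms.


(** * Lifting regular sequences from the associated graded ring *)

Section Lifting.
Variables (R : comNzRingType) (m : idealr R).
Local Notation G := {ideal_quot (gr_idealr m)}.
Local Notation E := (ideal_exp m).
Implicit Types (ws : seq (nat * R)).

Let Eideal i : is_ideal (E i). Proof. exact: ideal_exp_ideal. Qed.
Let Eadd i : add_closed (E i). Proof. exact/ideal_add/Eideal. Qed.
Let E0 i : E i 0. Proof. exact: is_ideal0 (Eideal i). Qed.
Let Ele i j x : (i <= j)%N -> E j x -> E i x. Proof. exact: ideal_exp_le. Qed.

(** A pair (d, x) in ws stands for an element x of m^d together with the degree d
    in which its initial form is taken. *)
Definition lifts ws : seq R := map snd ws.
Definition forms ws : seq G := map (fun w => init_form m w.1 w.2) ws.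
Definition graded_lift ws : Prop := forall w, w \in ws -> E w.1 w.2.

(** The sum of the m^(N-d) x for (d, x) in ws.  The subtraction is truncated, and
    for d > N the coefficient of x is arbitrary; then x is in m^(N+1), so that
    it contributes nothing in degree N. *)
Fixpoint filtered_span N ws : set R :=
  if ws is w :: ws' then
    [set z | exists a r, [/\ E (N - w.1) a, filtered_span N ws' r & z = a * w.2 + r]]
  else [set 0].

Lemma graded_lift_tail w ws : graded_lift (w :: ws) -> graded_lift ws.
Proof. by move=> h v vw; apply: h; rewrite inE vw orbT. Qed.

Lemma filtered_span_lspan N ws z : filtered_span N ws z -> lspan setT (lifts ws) z.
Proof.
elim: ws z => //= w ws IH z [a [r [_ Sr ->]]].
by exists a, r; split=> //; apply: IH.
Qed.

Lemma filtered_span0 ws z : lspan setT (lifts ws) z -> filtered_span 0 ws z.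
Proof.
elim: ws z => //= w ws IH z [a [r [_ Sr ->]]].
by exists a, r; split=> //; [rewrite sub0n ideal_exp0|apply: IH].
Qed.

Lemma filtered_spanD N ws x y :
  filtered_span N ws x -> filtered_span N ws y -> filtered_span N ws (x + y).
Proof.
elim: ws x y => /= [|w ws IH] x y; first by move=> -> ->; rewrite /= addr0.
move=> [a [r [Ea Sr ->]]] [b [t [Eb St ->]]]; exists (a + b), (r + t).
split; [exact: (add_closedD (Eadd _) Ea Eb)|exact: IH|ring].
Qed.

Lemma filtered_span_mul N d ws x y : E d y ->
  filtered_span (N - d) ws x -> filtered_span N ws (y * x).
Proof.
move=> Ey; elim: ws x => /= [|w ws IH] x; first by move=> ->; rewrite /= mulr0.
move=> [a [r [Ea Sr ->]]]; exists (y * a), (y * r); split; [|exact: IH|ring].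
by apply: Ele (ideal_expM Ey Ea); lia.
Qed.

Lemma filtered_span_sub N ws z : graded_lift ws -> filtered_span N ws z -> E N z.
Proof.
elim: ws z => /= [|w ws IH] z gl; first by move=> ->.
move=> [a [r [Ea Sr ->]]].
have Er := IH r (graded_lift_tail gl) Sr.
apply: (add_closedD (Eadd N)) => //.
by apply: Ele (ideal_expM Ea (gl w (mem_head _ _))); rewrite addnC -leq_subLR.
Qed.

Lemma init_form_term N (w : nat * R) a : E w.1 w.2 -> E (N - w.1) a ->
  init_form m N (a * w.2) =
  if (w.1 <= N)%N then init_form m (N - w.1) a * init_form m w.1 w.2 else 0.
Proof.
move=> hw ha; case: leqP => wN; first by rewrite -init_formM // subnK.
apply/init_form_eq0; last by apply: Ele wN _; apply: (is_idealMl a (Eideal _) hw).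
by apply: Ele (ltnW wN) _; apply: (is_idealMl a (Eideal _) hw).
Qed.

Lemma init_form_filtered N ws z : graded_lift ws -> filtered_span N ws z ->
  lspan setT (forms ws) (init_form m N z).
Proof.
elim: ws z => /= [|w ws IH] z gl; first by move=> ->; rewrite init_form0.
move=> [a [r [Ea Sr ->]]].
have gl' := graded_lift_tail gl; have hw := gl w (mem_head _ _).
have Er := filtered_span_sub gl' Sr.
have Eaw : E N (a * w.2) by apply: Ele (ideal_expM Ea hw); rewrite addnC -leq_subLR.
rewrite init_formD // init_form_term //.
case: ifP => _; last by exists 0, (init_form m N r); split; [|exact: IH|rewrite mul0r].
by exists (init_form m (N - w.1) a), (init_form m N r); split=> //; apply: IH.
Qed.

(** Only the components of degree N - d of the coefficients of u matter; lift them. *)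
Lemma lift_component N ws u : graded_lift ws -> lspan setT (forms ws) u ->
  exists2 z, filtered_span N ws z & component N u = init_form m N z.
Proof.
elim: ws u => /= [|w ws IH] u gl.
  by move=> ->; exists 0 => //; rewrite -(init_form0 m 0) component_init_form ?init_form0 ?if_same.
have gl' := graded_lift_tail gl; have hw := gl w (mem_head _ _).
move=> [b [r [_ Sr ->]]]; have [z Sz ez] := IH r gl' Sr.
have [c Ec ec] := componentP (N - w.1) b.
have Ez := filtered_span_sub gl' Sz.
have Ecw : E N (c * w.2) by apply: Ele (ideal_expM Ec hw); rewrite addnC -leq_subLR.
exists (c * w.2 + z); first by exists c, z.
rewrite componentD init_formD // ez; congr (_ + _).
rewrite init_form_term // mulrC
  (graded_mul_homog (@component_component _ m) (@componentM _ m) (d := w.1)); last first.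
  by rewrite component_init_form ?eqxx.
by case: ifP => // _; rewrite ec mulrC.
Qed.

Lemma lift_init_form N ws z : graded_lift ws -> E N z ->
  lspan setT (forms ws) (init_form m N z) ->
  exists2 w, filtered_span N ws w & E N.+1 (z - w).
Proof.
move=> gl Ez /(lift_component N gl)[w Sw].
rewrite component_init_form // eqxx => e; exists w => //.
by apply/init_form_eq => //; apply: filtered_span_sub Sw.
Qed.

(** If z = a x + r is a combination with coefficients of order n - d and z has
    order n + 1, then the initial form of a times that of x is in the ideal of the
    other initial forms; by regularity a = b modulo higher order, with b in the
    span of the other lifts, and b x can be moved to r.  So the order of the
    coefficients can be raised to that of z. *)
Lemma filtered_span_lift N ws z : graded_lift ws -> regular_seq setT (forms ws) ->
  E N z -> lspan setT (lifts ws) z -> filtered_span N ws z.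
Proof.
move=> gl reg ENz hz.
have step n : filtered_span n ws z -> E n.+1 z -> filtered_span n.+1 ws z.
  move: gl reg {ENz hz}; elim: ws z => [//|[d x] ws IH] z gl /= [reg nzd].
  have gl' := graded_lift_tail gl; have /= hx := gl _ (mem_head _ _).
  move=> [a [r [/= Ea Sr ez]]] Ez.
  have Er := filtered_span_sub gl' Sr.
  have [dn|nd] := leqP d n; last first.
    exists a, r; split=> //; first by rewrite /= (_ : n.+1 - d = 0)%N ?ideal_exp0 //; lia.
    apply: IH => //; have -> : r = z - a * x by rewrite ez; ring.
    apply: (Eadd _).2 => //.
    exact: (is_idealMl a (Eideal _) (Ele nd hx)).
  have Eax : E n (a * x) by apply: Ele (ideal_expM Ea hx); rewrite addnC -leq_subLR.
  have e0 : init_form m d x * init_form m (n - d) a + init_form m n r = 0.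
    rewrite mulrC -init_formM // subnK // -init_formD // -ez.
    by apply/init_form_eq0 => //; apply: ideal_expS.
  have /(lift_init_form gl' Ea)[b Sb Eab] : lspan setT (forms ws) (init_form m (n - d) a).
    apply: nzd => //; move/eqP: e0; rewrite addr_eq0 => /eqP ->.
    apply: is_idealN; first exact: lspan_ideal.
    exact: init_form_filtered.
  exists (a - b), (x * b + r); split; last by rewrite ez /=; ring.
    by rewrite /= subSn.
  apply: IH => //.
    by apply: filtered_spanD => //; apply: filtered_span_mul hx Sb.
  have -> : x * b + r = z - (a - b) * x by rewrite ez; ring.
  apply: (Eadd _).2 => //.
  by apply: Ele (ideal_expM Eab hx); lia.
elim: N ENz => [_|N IH ENz]; first exact: filtered_span0.
by apply: step => //; apply: IH; apply: ideal_expS.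
Qed.

Hypothesis noeR : noetherian R.
Hypothesis mU : forall a, a \notin m -> exists u, u * a = 1.

(** If x z is in (xs), then so is x e for every e with z = e modulo (xs).  If e is in
    m^k, then by [filtered_span_lift] the initial form of e times that of x is
    in the ideal of the other initial forms, and e can be changed into an
    element of m^(k+1). *)
Lemma lifts_regular ws : graded_lift ws -> regular_seq setT (forms ws) ->
  regular_seq setT (lifts ws).
Proof.
elim: ws => [//|[d x] ws IH] gl /= [reg nzd].
have gl' := graded_lift_tail gl; have /= hx := gl _ (mem_head _ _).
split; first exact: IH.
move=> z _ hz; have hI := lspan_ideal (lifts ws).
apply: (krull_intersection noeR mU) => // k.
elim: k => [|k [e Ee hze]].
  by exists z; rewrite ?ideal_exp0 // subrr; apply: is_ideal0.
have Sxe : filtered_span (d + k) ws (x * e).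
  apply: filtered_span_lift => //; first exact: ideal_expM.
  have -> : x * e = x * z - x * (z - e) by ring.
  by apply: is_idealB => //; apply: is_idealMl.
have /(lift_init_form gl' Ee)[b Sb Eeb] : lspan setT (forms ws) (init_form m k e).
  by apply: nzd => //; rewrite -init_formM //; apply: init_form_filtered.
exists (e - b) => //; have -> : z - (e - b) = (z - e) + b by ring.
by apply: is_idealD => //; apply: filtered_span_lspan Sb.
Qed.

(** An element of m^k, k >= N, can be changed modulo the lifts into an element of
    m^(k+1). *)
Lemma lifts_primary ws N : graded_lift ws ->
  (forall d x, (N <= d)%N -> lspan setT (forms ws) (component d x)) ->
  E N `<=` lspan setT (lifts ws).
Proof.
move=> gl h z EN; apply: (krull_intersection noeR mU); first exact: lspan_ideal.
move=> k; suff [e Ee hze] : exists2 e, E (N + k) e & lspan setT (lifts ws) (z - e).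
  by exists e => //; apply: Ele Ee; rewrite leq_addl.
have hI := lspan_ideal (lifts ws).
elim: k => [|k [e Ee hze]].
  by exists z; rewrite ?addn0 // subrr; apply: is_ideal0.
have /(lift_init_form gl Ee)[b Sb Eeb] : lspan setT (forms ws) (init_form m (N + k) e).
  by have := h (N + k)%N (init_form m (N + k) e) (leq_addr _ _); rewrite component_init_form // eqxx.
exists (e - b); first by rewrite addnS.
have -> : z - (e - b) = (z - e) + b by ring.
by apply: is_idealD => //; apply: filtered_span_lspan Sb.
Qed.

Definition pow_lift q ws : seq (nat * R) := map (fun w => (w.1 * q, w.2 ^+ q)%N) ws.

(** Let r be the order of c.  An f in m^k with z = f modulo the lifts satisfies the same
    relations c f^q in (xs^[q]) as z, so the class of f in degree k is in the tight
    closure of the ideal of initial forms, with the multiplier in(c).  So f can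
    be changed into an element of m^(k+1). *)
Lemma lifts_tight_closed p ws c z : p \in [pchar R] -> F_rational (assoc_graded m) p ->
  graded_lift ws -> regular_seq setT (forms ws) -> c <> 0 ->
  (exists e0, forall e, (e0 <= e)%N ->
     lspan setT (pow_seq (p ^ e) (lifts ws)) (c * z ^+ (p ^ e))) ->
  lspan setT (lifts ws) z.
Proof.
move=> charp FR gl reg c0 [e0 hc].
have hI := lspan_ideal (lifts ws).
have domG := frational_graded_domain (@componentB _ m) (@component_component _ m)
  (@component_sum _ m) (@componentM _ m) (component1 m) (component_unit mU) FR.
have [r Ecr nEcr] : exists2 r, E r c & ~ E r.+1 c.
  have ex : exists k, `[< ~ E k c >].
    apply: contrapT => h; apply: c0.
    suff : lspan setT [::] c by [].
    apply: (krull_intersection noeR mU); first exact: lspan_ideal.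
    move=> k; exists c; last by rewrite /= subrr.
    by apply: contrapT => nE; apply: h; exists k; apply/asboolP.
  case: (ex_minnP ex) => -[|r] /asboolP nE mn.
    by case: nE; rewrite ideal_exp0.
  exists r => //; apply: contrapT => /asboolP/mn.
  by rewrite ltnn.
have c1 : init_form m r c <> 0 by move=> /(init_form_eq0 Ecr).
apply: (krull_intersection noeR mU) => // k.
elim: k => [|k [f Ef hzf]].
  by exists z; rewrite ?ideal_exp0 // subrr; apply: is_ideal0.
have /(lift_init_form gl Ef)[b Sb Efb] : lspan setT (forms ws) (init_form m k f).
  apply: (frational_tight_closed FR reg (c := init_form m r c)).
    by move=> x /domG[].
  exists e0 => e /hc h; set q := (p ^ e)%N in h *.
  have Efq := @ideal_expX _ m k f q Ef; rewrite -init_formX // -init_formM //.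
  have -> : pow_seq q (forms ws) = forms (pow_lift q ws).
    rewrite /pow_seq /forms /pow_lift -!map_comp; apply/eq_in_map => w ww /=.
    by rewrite init_formX //; apply: gl.
  have gl' : graded_lift (pow_lift q ws) by move=> _ /mapP[w /gl ww ->] /=; apply: ideal_expX.
  apply: init_form_filtered => //; apply: filtered_span_lift => //.
  - have <- : pow_seq q (forms ws) = forms (pow_lift q ws).
      rewrite /pow_seq /forms /pow_lift -!map_comp; apply/eq_in_map => w ww /=.
      by rewrite init_formX //; apply: gl.
    exact: regular_seq_pow.
  - by apply: ideal_expM => //; apply: ideal_expX.
  have <- : pow_seq q (lifts ws) = lifts (pow_lift q ws).
    by rewrite /pow_seq /lifts /pow_lift -!map_comp.
  have -> : c * f ^+ q = c * z ^+ q - c * (z - f) ^+ q.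
    have pc : [pchar R].-nat q by apply: pchar_pow_nat.
    have -> : z ^+ q = (z - f) ^+ q + f ^+ q by rewrite -exprDn_pchar // subrK.
    by ring.
  have hq := lspan_ideal (pow_seq q (lifts ws)).
  by apply: is_idealB => //; apply: is_idealMl => //; apply: lspan_pow.
exists (f - b) => //; have -> : z - (f - b) = (z - f) + b by ring.
by apply: is_idealD => //; apply: filtered_span_lspan Sb.
Qed.

Lemma exists_lift (ys : seq G) : (forall y, y \in ys -> pos_homog (@component _ m) y) ->
  exists2 ws, graded_lift ws & forms ws = ys /\ forall x, x \in lifts ws -> x \in m.
Proof.
elim: ys => [|y ys IH] h; first by exists [::].
have [|ws gl [fe xm]] := IH; first by move=> z zy; apply: h; rewrite inE zy orbT.
have [d d0 hy] := h y (mem_head _ _).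
have [x Ex ex] := componentP d y.
exists ((d, x) :: ws).
  by move=> w; rewrite inE => /orP[/eqP->//|/gl].
split; first by rewrite /= fe -ex hy.
move=> z; rewrite inE => /orP[/eqP->|/xm//].
by apply: ideal_exp1; apply: Ele Ex.
Qed.

End Lifting.


(** * Parameter ideals of a local domain *)

Lemma local_ring_units (R : comNzRingType) (m : idealr R) : noetherian R ->
  local_ring m -> forall a, a \notin m -> exists u, u * a = 1.
Proof.
move=> noeR [_ mmax] a am; apply: contrapT => nu; move/negP: am; apply.
have nI1 : ~ lspan setT [:: a] 1.
  by move=> [u [r [_ /= -> e]]]; apply: nu; exists u; rewrite e addr0.
have [I [] //||J [hJ nJ1] [IJ mx]] := @noeth_max _
  [set J | is_ideal J /\ ~ J 1] (lspan setT [:: a]) noeR.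
  by split=> //; apply: lspan_ideal.
have [J' eJ] := exists_idealr hJ nJ1.
have : maximal_ideal J'.
  move=> K sJK x Kx; suff : [set` J'] x by [].
  rewrite eJ; apply: (mx [set` K]) => //.
    by split; [exact: idealr_is_ideal|rewrite /= idealr1].
  by move=> y; rewrite -eJ => /sJK.
move=> /mmax <-; suff : [set` J'] a by [].
by rewrite eJ; apply: IJ; apply: mem_lspan; apply: mem_head.
Qed.

Section LocalDomain.
Variables (R : idomainType) (m : idealr R) (p : nat).
Hypotheses (noeR : noetherian R) (charp : p \in [pchar R]).
Hypothesis mU : forall a, a \notin m -> exists u, u * a = 1.
Implicit Types (l w s t : seq R).

Let pc e : [pchar R].-nat (p ^ e)%N.
Proof. exact: pchar_pow_nat. Qed.

(** Tight closedness of the ideal generated by l, for a domain, where the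
    multipliers are the nonzero elements. *)
Definition tightly_closed l : Prop := forall z c, c <> 0 ->
  (exists e0, forall e, (e0 <= e)%N ->
     lspan setT (pow_seq (p ^ e) l) (c * z ^+ (p ^ e))) ->
  lspan setT l z.

Definition regular_closed l : Prop := regular_seq setT l /\ tightly_closed l.

(** Expressed by primes; in a noetherian ring, it means that l generates an ideal
    primary to m. *)
Definition primary l : Prop := (forall y, y \in l -> y \in m) /\
  forall Q, set_prime Q -> lspan setT l `<=` Q -> [set` m] `<=` Q.

Lemma primary_perm l l' : l =i l' -> primary l -> primary l'.
Proof.
move=> e [lm lQ]; split=> [y|Q]; first by rewrite -e; apply: lm.
by rewrite -(eq_mem_lspan _ e) //; apply: lQ.
Qed.

Lemma regular_closed_perm l l' : (forall y, y \in l -> y \in m) -> perm_eq l l' ->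
  regular_closed l -> regular_closed l'.
Proof.
move=> lm pe [reg tc]; split; first exact: (regular_perm noeR mU lm pe reg).
move=> z c c0 [e0 h]; rewrite -(eq_mem_lspan _ (perm_mem pe)) //.
apply: (tc z c c0); exists e0 => e /h.
by rewrite (eq_mem_lspan _ (perm_mem (perm_map _ pe))).
Qed.

(** Let z be in the tight closure of (u^(k+1), l).  By induction z = u^k w modulo
    (l), and u^(k q), a nonzerodivisor modulo l^[q], can be cancelled in the
    relations for u^k w; so w is in the tight closure of (u, l). *)
Lemma regular_closed_pow u l k : regular_closed (u :: l) -> regular_closed (u ^+ k :: l).
Proof.
move=> [reg tc]; split; first exact: (regular_seq_pow1 (@subringT _) (l1 := [::])).
elim: k => [|k IH] z c c0 [e0 h].
  exists z, 0; rewrite expr0 mulr1 addr0; split=> //.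
  exact: is_ideal0 (lspan_ideal l).
have hq e := lspan_ideal (pow_seq (p ^ e) l).
have [w [r [_ Sr ez]]] : lspan setT (u ^+ k :: l) z.
  apply: (IH z c c0); exists e0 => e /h [a [b [_ Sb eb]]].
  exists (a * u ^+ (p ^ e)), b; split=> //.
  by rewrite eb exprSr exprMn; ring.
have [a [b [_ Sb ew]]] : lspan setT (u :: l) w.
  apply: (tc w c c0); exists e0 => e e0e; have [a [b [_ Sb eb]]] := h e e0e.
  set q := (p ^ e)%N in eb Sb *.
  have [_ nzd] : regular_seq setT (pow_seq q (u ^+ k :: l)).
    by apply: regular_seq_pow => //; apply: (regular_seq_pow1 (@subringT _) (l1 := [::])).
  exists a, (c * w ^+ q - a * u ^+ q); split=> //; last by rewrite /=; ring.
  apply: nzd => //.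
  have -> : (u ^+ k) ^+ q * (c * w ^+ q - a * u ^+ q) = b - c * r ^+ q.
    have ezq : z ^+ q = w ^+ q * (u ^+ k) ^+ q + r ^+ q.
      by rewrite ez exprDn_pchar ?pc // exprMn.
    have -> : b = c * z ^+ q - a * (u ^+ k.+1) ^+ q by rewrite eb /=; ring.
    by rewrite ezq exprS exprMn; ring.
  exact: (is_idealB (hq e) Sb (is_idealMl c (hq e) (lspan_pow charp e Sr))).
exists a, (u ^+ k * b + r); split=> //.
  by apply: is_idealD; [exact: lspan_ideal|apply: is_idealMl => //; exact: lspan_ideal|].
by rewrite ez ew exprS; ring.
Qed.

(** As u^k = r v modulo l is a nonzerodivisor modulo l, so are r and v, and
    multiplication by r embeds R/(v, l) into R/(u^k, l), where (u^k, l) is already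
    known to be tightly closed. *)
Lemma regular_closed_exchange u v l : regular_closed (u :: l) ->
  (exists k, lspan setT (v :: l) (u ^+ k)) -> regular_closed (v :: l).
Proof.
move=> Tu [k [r [x [_ Sx ek]]]].
have [[regl nzdk] tck] := regular_closed_pow k Tu.
have hl := lspan_ideal l.
split.
  split=> // a _ hva; apply: nzdk => //; rewrite ek.
  have -> : (r * v + x) * a = r * (v * a) + x * a by ring.
  by apply: is_idealD => //; [exact: is_idealMl|exact: is_idealMr].
move=> z c c0 [e0 h].
have [a [b [_ Sb erz]]] : lspan setT (u ^+ k :: l) (r * z).
  apply: (tck (r * z) c c0); exists e0 => e e0e; have [a [b [_ Sb eb]]] := h e e0e.
  set q := (p ^ e)%N in eb Sb *.
  have hq := lspan_ideal (pow_seq q l).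
  exists a, (r ^+ q * b - a * x ^+ q); split=> //.
    exact: (is_idealB hq (is_idealMl _ hq Sb) (is_idealMl a hq (lspan_pow charp e Sx))).
  by rewrite /= ek exprDn_pchar ?pc // !exprMn mulrCA eb /=; ring.
exists a, (z - a * v); split=> //; last by ring.
apply: nzdk => //.
have -> : u ^+ k * (z - a * v) = v * (a * x + b) + x * (z - a * v) by
  rewrite ek; transitivity (v * (r * z - a * r * v) + x * (z - a * v)); [ring|rewrite erz ek; ring].
apply: is_idealD => //; last exact: is_idealMr.
apply: is_idealMl => //; apply: is_idealD => //; exact: is_idealMl.
Qed.

(** The tight closure of (l) is in (u^k, l) for all k. *)
Lemma regular_closed_drop u l : u \in m -> regular_closed (u :: l) -> regular_closed l.
Proof.
move=> um Tu; split; first by case: Tu => -[].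
move=> z c c0 [e0 h]; apply: (krull_intersection noeR mU); first exact: lspan_ideal.
move=> k; have [_ tck] := regular_closed_pow k Tu.
have [a [b [_ Sb ez]]] : lspan setT (u ^+ k :: l) z.
  apply: (tck z c c0); exists e0 => e /h; exact: lspan_cons.
exists (a * u ^+ k); last by rewrite ez addrC addKr.
by apply: (is_idealMl a (ideal_exp_ideal m k)); apply: ideal_exp_pow.
Qed.

Lemma primary_pow l x : primary l -> x \in m -> exists n, lspan setT l (x ^+ n).
Proof.
move=> [_ lQ] xm; apply: (radical_primes noeR (lspan_ideal l)) => Q pQ lQ'.
exact: lQ.
Qed.

Lemma primary_minimal l : primary l -> minimal_over (lspan setT l) [set` m].
Proof.
move=> [lm lQ]; split=> [|y|Q pQ h _]; [exact: max_set_prime| |exact: lQ].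
by apply: lspan_le_ideal; [exact: idealr_is_ideal|exact: lm].
Qed.

Section Dimension.
Variables (n : nat) (C : nat -> set R).
Hypotheses (chC : set_prime_chain n C) (Cm : C n `<=` [set` m]).

Lemma minimal_avoids_max l P : (size l < n)%N -> minimal_over (lspan setT l) P ->
  exists2 y, y \in m & ~ P y.
Proof.
move=> ln mP; apply: contrapT => h.
have mP' : [set` m] `<=` P.
  by move=> y ym; apply: contrapT => nPy; apply: h; exists y.
have := krull_height noeR mP chC (fun x Cx => mP' x (Cm Cx)).
by rewrite leqNgt ln.
Qed.

(** If P is a minimal prime over l, then m is minimal over P + (a), so no prime lies
    strictly between P and m by the principal ideal theorem; a prime containing
    P and v is therefore m. *)
Lemma primary_exchange a l v : primary (a :: l) -> v \in m ->
  (forall P, minimal_over (lspan setT l) P -> ~ P v) -> primary (v :: l).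
Proof.
move=> [alm alQ] vm nv; split.
  by move=> y; rewrite inE => /orP[/eqP->//|yl]; apply: alm; rewrite inE yl orbT.
move=> Q pQ vlQ; apply: contrapT => nmQ.
have [|P mP PQ] := exists_minimal_le noeR (lspan_ideal l) pQ.
  by move=> y yl; apply: vlQ; apply: lspan_cons.
have [pP lP _] := mP; apply: (nv P mP).
have [hQ nQ1 _] := pQ.
have Qm := proper_sub_max mU hQ nQ1.
suff : Q `<=` P by apply; apply: vlQ; apply: mem_lspan; apply: mem_head.
apply: (principal_ideal_theorem noeR pP pQ (max_set_prime mU) PQ Qm (x := a)) => //.
  by apply: alm; apply: mem_head.
move=> P' pP' PP' P'a _; apply: alQ => // _ [b [r [_ Sr ->]]].
have [hP' _ _] := pP'.
by apply: is_idealD => //; [exact: is_idealMl|apply: PP'; apply: lP].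
Qed.

Lemma exists_common_exchange a l b l' : size l = size l' -> (size l < n)%N ->
  primary (a :: l) -> primary (b :: l') ->
  exists2 v, v \in m & primary (v :: l) /\ primary (v :: l').
Proof.
move=> es ln pa pb.
have [L [hL pL]] := minimal_primes noeR (lspan_ideal l).
have [L' [hL' pL']] := minimal_primes noeR (lspan_ideal l').
have [||||v _ [vm nv]] := @prime_avoidance R setT _ _ [set` m] (L ++ L') (idealr_is_ideal m).
- by [].
- by move=> x y _ _; exists 1%N, 1%N.
- by exists 0 => //; apply: idealr0.
- move=> P; rewrite mem_cat => /orP[/hL|/hL'] mP; have [pP _ _] := mP; split=> //.
    by have [y ym nPy] := minimal_avoids_max ln mP; exists y.
  by rewrite es in ln; have [y ym nPy] := minimal_avoids_max ln mP; exists y.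
have avoid (K : seq (set R)) k P : {subset K <= L ++ L'} -> (forall P, P \in K -> minimal_over (lspan setT k) P) ->
    (forall Q, set_prime Q -> lspan setT k `<=` Q -> exists2 P, P \in K & P `<=` Q) ->
    minimal_over (lspan setT k) P -> ~ P v.
  move=> KL hK pK [pP kP mP] Pv; have [P' P'K P'P] := pK P pP kP.
  apply: (nv P' (KL _ P'K)); have [pP' kP' _] := hK P' P'K; exact: mP.
exists v => //; split; [apply: primary_exchange pa vm _|apply: primary_exchange pb vm _].
  by move=> P; apply: (avoid L l P) => // Q QL; rewrite mem_cat QL.
by move=> P; apply: (avoid L' l' P) => // Q QL; rewrite mem_cat QL orbT.
Qed.

(** Exchange the heads of a and b against a common v, and proceed with v in the
    common part w. *)
Lemma regular_closed_connect w a b : size a = size b -> size (w ++ a) = n ->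
  primary (w ++ a) -> primary (w ++ b) -> regular_closed (w ++ a) ->
  regular_closed (w ++ b).
Proof.
have mid l1 x l : l1 ++ x :: l =i x :: l1 ++ l.
  by move=> z; rewrite !(mem_cat, inE) orbCA.
have pmid l1 x l : perm_eq (l1 ++ x :: l) (x :: l1 ++ l).
  by rewrite (perm_catCA l1 [:: x] l).
elim: a w b => [|a1 a IH] w [|b1 b] //= [es] sn pa pb Ta.
have pa' := primary_perm (mid _ _ _) pa; have pb' := primary_perm (mid _ _ _) pb.
have [||v vm [pva pvb]] := exists_common_exchange _ _ pa' pb'.
- by rewrite !size_cat es.
- by rewrite -sn !size_cat /= addnS.
have Tv : regular_closed (v :: w ++ a).
  apply: (regular_closed_exchange (u := a1)).
    by apply: regular_closed_perm Ta => //; case: pa.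
  by apply: primary_pow pva _; case: pa' => h _; apply: h; apply: mem_head.
have Tvb : regular_closed ((v :: w) ++ b).
  by apply: (IH (v :: w) b) => //=; rewrite -sn !size_cat /= addnS.
have Tb : regular_closed (b1 :: w ++ b).
  by apply: regular_closed_exchange Tvb _; apply: primary_pow pb' vm.
apply: regular_closed_perm Tb; first by case: pb'.
by rewrite perm_sym.
Qed.

End Dimension.

Section ParameterIdeals.
Variable P : prime_idealr R.
Local Notation loc := (to_localization P).

(** Clear the denominators of the elements that extend s to a system of parameters
    of R_m, and contract a maximal chain of primes of R_m. *)
Lemma parameters_extend s : [set` P] = [set` m] ->
  parameters s -> (forall y, y \in s -> y \in m) ->
  exists t, primary (s ++ t) /\
    exists C, set_prime_chain (size (s ++ t)) C /\ C (size (s ++ t)) `<=` [set` m].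
Proof.
move=> ePm par sm.
have PE x : (x \in P) = (x \in m).
  by apply/idP/idP => h; [suff : [set` m] x by []|suff : [set` P] x by []]; rewrite ?ePm // -ePm.
have [|t [M [lclM [[C chC] _] radM]]] := par P.
  rewrite ideal_genE; apply: lspan_le_ideal; first exact: idealr_is_ideal.
  by move=> y /sm; rewrite /= PE.
have noeL := @loc_noetherian _ P noeR.
have MU := local_ring_units noeL lclM.
have /choice[den hden] : forall z : localization P, exists s0 : R, s0 \notin P /\
    exists a, z * loc s0 = loc a.
  by move=> z; have [a [s0 [sP e]]] := loc_frac z; exists s0; split=> //; exists a.
have /choice[num hnum] : forall z : localization P, exists a, z * loc (den z) = loc a.
  by move=> z; have [_] := hden z.
have denP z : den z \notin P by case: (hden z).
have unitM (z : localization P) u : z \in M -> u * z = 1 -> False.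
  by move=> zM e; have := idealMr u zM; rewrite e idealr1.
have tM z : z \in t -> z \in M.
  move=> zt; suff : [set` M] z by [].
  rewrite -radM; exists 1%N; rewrite expr1; apply: sub_gen_smallest => /=.
  by rewrite mem_cat zt orbT.
exists (map num t); split; first split.
- move=> y; rewrite mem_cat => /orP[/sm//|/mapP[z zt ->]].
  rewrite -PE; apply/negPn/negP => /loc_unit[u e].
  apply: (unitM z (u * loc (den z)) (tM z zt)).
  by rewrite -mulrA [_ * z]mulrC hnum.
- move=> Q pQ stQ x xm; have [hQ nQ1 _] := pQ.
  have notQ y : y \notin P -> ~ Q y.
    move=> yP Qy; have := proper_sub_max mU hQ nQ1 Qy; rewrite /= -PE.
    by rewrite (negbTE yP).
  have locx : loc x \in M.
    apply/negPn/negP => /MU[z e].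
    have : loc (num z * x) = loc (den z).
      by rewrite locM -hnum mulrAC e mul1r.
    move=> /loc_eq[u uP eu]; have := notin_mul uP (denP z).
    by rewrite -eu PE mulrA idealMr.
  have [n] : radical (ideal_gen [set` map loc s ++ t]) (loc x) by rewrite radM.
  rewrite ideal_genE => hx.
  have : lspan setT (map loc (s ++ map num t)) (loc x ^+ n).
    move: hx; apply: lspan_le_ideal; first exact: lspan_ideal.
    move=> z; rewrite mem_cat map_cat => /orP[zs|zt].
      by apply: mem_lspan; rewrite mem_cat zs.
    have [v ev] := loc_unit (denP z).
    have -> : z = v * loc (num z) by rewrite -hnum mulrCA ev mulr1.
    apply: is_idealMl; first exact: lspan_ideal.
    by apply: mem_lspan; rewrite mem_cat; apply/orP; right; do 2!apply: map_f.
  move=> /loc_lspan[s0 [b [s0P Sb e]]].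
  have [|u uP eu] := @loc_eq _ P (x ^+ n * s0) b; first by rewrite locM locX.
  apply: (primeX pQ (n := n)); have [_ _ QM] := pQ.
  case: (QM (x ^+ n) (u * s0)) => //.
    by rewrite mulrCA eu; apply: is_idealMl => //; apply: stQ.
  by move/(notQ _ (notin_mul uP s0P)).
have -> : size (s ++ map num t) = size (map loc s ++ t) by rewrite !size_cat !size_map.
set n := size _ in chC *.
have pC i : set_prime [set` C i] by apply: prime_idealr_set_prime.
exists (fun i => [set a | loc a \in C i]); split.
  split=> [i _|i il].
    have [hC nC1 CM] := pC i; split.
    - split=> /= [|x y hx hy|a x hx]; first by rewrite loc0 idealr0.
        by rewrite locD rpredD.
      by rewrite locM idealMr.
    - by rewrite /= loc1 idealr1.
    - by move=> a b /=; rewrite locM => /CM.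
  have [CC nCC] := chC i il; split=> [x /= /CC //|h]; apply: nCC => z zC.
  have : loc (num z) \in C i by apply: h; rewrite /= -hnum mulrC idealMr.
  rewrite -hnum => /(prime_idealr_closed_subproof)/orP[//|dC].
  have [u e] := loc_unit (denP z).
  by have := idealMr u dC; rewrite e idealr1.
move=> a /= aC; rewrite -PE; apply/negPn/negP => /loc_unit[u e].
by have := idealMr u aC; rewrite e idealr1.
Qed.

End ParameterIdeals.

Lemma zero_minimal_prime : exists2 Z : prime_idealr R, minimal_prime Z & 0 \in Z.
Proof.
have [|Z eZ] := @exists_prime_idealr R [set 0].
  split; [exact: (lspan_ideal ([::] : seq R))|exact/eqP/oner_neq0|].
  by move=> a b /= /eqP; rewrite mulf_eq0 => /orP[]/eqP; [left|right].
exists Z; last exact: idealr0.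
move=> Q _ x xZ; have : [set` Z] x by [].
by rewrite eZ => /= ->; apply: idealr0.
Qed.

Lemma frational_of_system xs : regular_closed xs -> primary xs -> F_rational R p.
Proof.
move=> Tx px; split=> // s par; apply/seteqP; split; last first.
  move=> x hx; exists 1; split; first by move=> P _; rewrite idealr1.
  exists 0%N => e _; rewrite mul1r frobenius_power_lspan //.
  by apply: lspan_pow => //; rewrite -ideal_genE.
have pm := max_set_prime mU; have [P eP] := exists_prime_idealr pm.
have [sm|/existsNP[y /not_implyP[ys /negP ym]]] :=
    pselect (forall y, y \in s -> y \in m); last first.
  move=> x _; rewrite ideal_genE; have [u e] := mU ym.
  rewrite -[x]mulr1 -e mulrA; apply: is_idealMl; first exact: lspan_ideal.
  exact: mem_lspan.
have [t [pst [C [chC Cm]]]] := parameters_extend eP par sm.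
have [C' [chC' eC']] : exists C', set_prime_chain (size xs) C' /\ C' (size xs) = [set` m].
  have [regx _] := Tx; apply: (regular_height noeR regx pm).
  by have [_ h _] := primary_minimal px.
have le1 : (size (s ++ t) <= size xs)%N.
  exact: krull_height (primary_minimal px) chC Cm.
have le2 : (size xs <= size (s ++ t))%N.
  by apply: (krull_height noeR (primary_minimal pst) chC'); rewrite eC'.
have es : size xs = size (s ++ t) by apply/eqP; rewrite eqn_leq le1 le2.
have Tst : regular_closed (s ++ t).
  have Cm' : C' (size xs) `<=` [set` m] by rewrite eC'.
  exact: (@regular_closed_connect (size xs) C' chC' Cm' [::] xs (s ++ t)).
have : regular_closed (t ++ s).
  by apply: regular_closed_perm Tst; [case: pst|rewrite perm_catC].
have : forall y, y \in t -> y \in m.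
  by case: pst => h _ y yt; apply: h; rewrite mem_cat yt orbT.
elim: t {pst C chC Cm le1 le2 es Tst} => [|u t IH] tm.
  move=> [_ tc] x [c [hc [e0 he]]]; rewrite ideal_genE; apply: (tc x c).
    move=> c0; have [Z mZ Z0] := zero_minimal_prime.
    by move/negP: (hc Z mZ); rewrite c0.
  by exists e0 => e /he; rewrite frobenius_power_lspan.
move=> /regular_closed_drop h; apply: IH; last by apply: h; apply: tm; apply: mem_head.
by move=> y yt; apply: tm; rewrite inE yt orbT.
Qed.

End LocalDomain.


Theorem corollary2 (R : idomainType) (m : idealr R) (p d : nat)
    (pcharRp : p \in [pchar R]%R) :
  noetherian R -> local_ring m -> krull_dim R d -> F_finite pcharRp ->
  F_rational (assoc_graded m) p -> F_rational R p.
Proof.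
move=> noeR lm _ _ FR.
have mU := local_ring_units noeR lm.
have [ys [yH reg [N hN]]] := frational_homog_system (@componentB _ m)
  (@component_component _ m) (@component_sum _ m) (@componentM _ m) (component1 m)
  (component_unit mU) FR (@component_gen _ m).
have [ws gl [fe wm]] := exists_lift yH.
rewrite -fe in reg hN.
apply: (@frational_of_system R m p noeR pcharRp mU (lifts ws)).
  split; first exact: lifts_regular gl reg.
  by move=> z c c0; apply: lifts_tight_closed pcharRp FR gl reg c0.
split=> // Q pQ lQ x xm; apply: (primeX pQ (n := N)).
by apply: lQ; apply: (lifts_primary noeR mU gl hN); apply: ideal_exp_pow.
Qed.
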